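(* For the matrix Charlier polynomials $(P_n^{(\lambda)})_n$, the difference operators $D_1=\mathfrak D^{(\lambda)}$, $D_2=\Delta S^{(\lambda)}$ and $D_3=S^{(\lambda-1)}\Delta$ are elements of $\mathcal B_R^2(P^{(\lambda)})$. For $D_1$ and $D_2$ this holds for $\lambda\in\mathbb N_0$, and for $D_3$ for $\lambda\in\mathbb N=\{1,2,\dots\}$.
   Context: $N\ge1$, $a>0$, $\mathbb N_0=\{0,1,2,\dots\}$. $\mu_1,\dots,\mu_N>0$ satisfy $(\mu_j/\mu_k)^2=a^{k-j}\frac{(N-k)!}{(N-j)!}$ and $\delta_k^{(\lambda)}=(a/2)^\lambda\frac{(\lambda+k-1)!}{(k-1)!}$. $A$ is the $N\times N$ matrix whose only nonzero entries are $A_{k+1,k}=\mu_{k+1}/\mu_k=\sqrt{(N-k)/a}$, $1\le k\le N-1$; $J=\mathrm{diag}(1,\dots,N)$; $T^{(\lambda)}=\mathrm{diag}(\delta_1^{(\lambda)},\dots,\delta_N^{(\lambda)})$. $W^{(\lambda)}(x)=\frac{a^x}{x!}(I+A)^{x+\lambda}T^{(\lambda)}(I+A^* )^{x+\lambda}$ for $x\in\mathbb N_0$; $P_n^{(\lambda)}$ are the monic matrix polynomials, $\deg P_n^{(\lambda)}=n$, orthogonal for $\langle P,Q\rangle^{(\lambda)}=\sum_{x=0}^\infty P(x)W^{(\lambda)}(x)Q(x)^*$. Operators act from the right, $(P\cdot\sum_j\eta^jF_j(x))(x)=\sum_jP(x+j)F_j(x)$, products acting left factor first. $\Delta=\eta-1$,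 $$\mathfrak D^{(\lambda)}=\eta\,a(I+A)-J-(x+\lambda)(I+A)^{-1}+\eta^{-1}x(I+A)^{-1},$$ $S^{(\lambda)}=-\Phi^{(\lambda)}(x)^*+\eta^{-1}(\Phi^{(\lambda)}(x)^*-\Psi^{(\lambda)}(x)^* )$, where $\Phi^{(\lambda)}(x)^*=\frac a2(I+A)^{x+\lambda+1}(J(I+A^* )+\lambda I)(I+A)^{-x-\lambda}$ and $\Phi^{(\lambda)}(x)^*-\Psi^{(\lambda)}(x)^*=\frac x2(I+A)^{x+\lambda}(J+\lambda I)(I+A)^{-x-\lambda}$ are matrix polynomials in $x$. Condition (V) on a function $\rho:\mathbb N_0\to M_N(\mathbb C)$: each entry of $\rho(n)$ is a rational function of $n$ without poles in $\mathbb N_0$, and for every $x\in\mathbb N_0$ there exist $k_0,\dots,k_x\in\mathbb N_0$ such that the block Vandermonde matrix with $(i,j)$ block $\rho(k_i)^j$, $0\le i,j\le x$, is invertible. $\mathcal B_R^2(P)$, for a sequence $(P_n)_n$ of monic matrix orthogonal polynomials, is the set of operators $D=\eta F_1(x)+F_0(x)+\eta^{-1}F_{-1}(x)$ with $F_1,F_0,F_{-1}$ matrix valued rational functions such that: there is a matrix sequence $\Gamma_n$ with $P_n\cdot D=\Gamma_nP_n$ for all $n\in\mathbb N_0$; $P_n(0)$ is invertible for all $n\in\mathbb N_0$; $P_n(0)^{-1}P_n(-1)F_{-1}(0)$ is independent of $n$; $F_1(x)$ is nonsingular for all $x\in\mathbb N_0$; and $\rho(n)=P_n(0)^{-1}\Gamma_nP_n(0)$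 satisfies Condition (V). *)

(* Defs.v *)
From HB Require Import structures.
From mathcomp Require Import all_boot all_order all_algebra ring.
From mathcomp Require Import complex.
From mathcomp Require Import classical_sets reals topology normedtype sequences.

Set Implicit Arguments.
Unset Strict Implicit.
Unset Printing Implicit Defensive.

Import Order.TTheory GRing.Theory Num.Theory.
Import numFieldNormedType.Exports.
Local Open Scope classical_set_scope.
Local Open Scope ring_scope.
Local Open Scope sesquilinear_scope.

Notation ratfun C := {fraction {poly C}}.

Definition evalmx (C : fieldType) (N : nat) (P : 'M[{poly C}]_N) (x : C) :
  'M[C]_N := map_mx (horner^~ x) P.

Definition monic_deg (C : fieldType) (N n : nat) (P : 'M[{poly C}]_N) : Prop :=
  map_mx (coefp n) P = 1%:M /\
  forall k, (n < k)%N -> map_mx (coefp k) P = 0.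

Definition polymx (C : fieldType) (N : nat) (P : 'M[{poly C}]_N) :
  'M[ratfun C]_N := map_mx (@FracField.tofrac _) P.

Definition constmx (C : fieldType) (N : nat) (M : 'M[C]_N) : 'M[ratfun C]_N :=
  polymx (map_mx polyC M).

(* [f] has no pole at [x] and takes the value [v] there. *)
Definition rat_value (C : fieldType) (f : ratfun C) (x v : C) : Prop :=
  exists p q : {poly C},
    [/\ q.[x] != 0, f = FracField.tofrac p / FracField.tofrac q
      & v = p.[x] / q.[x]].

Definition ratmx_value (C : fieldType) (N : nat) (F : 'M[ratfun C]_N) (x : C)
  (V : 'M[C]_N) : Prop := forall i j, rat_value (F i j) x (V i j).

(* The substitution f(x) |-> f(x + c). The choice of the representative of the
   fraction does not matter, see [fshiftE]. *)
Definition fshift (C : fieldType) (c : C) (f : ratfun C) : ratfun C :=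
  let r := repr f in
  FracField.tofrac ((\n_r) \Po ('X + c%:P)) /
  FracField.tofrac ((\d_r) \Po ('X + c%:P)).

Lemma frac_repr (R : idomainType) (f : {fraction R}) :
  f = FracField.tofrac (\n_(repr f)) / FracField.tofrac (\d_(repr f)).
Proof.
have dF0 : FracField.tofrac (\d_(repr f)) != 0.
  by rewrite tofrac_eq0 denom_ratioP.
apply: (mulIf dF0); rewrite mulfVK // -{1}[f]reprK.
unlock FracField.tofrac; rewrite -[LHS]FracField.pi_mul.
apply/eqmodP; rewrite /= FracField.equivfE /FracField.mulf.
by rewrite !numden_Ratio ?mulf_neq0 ?oner_neq0 ?denom_ratioP // !mulr1 mulrC.
Qed.

Lemma fshiftE (C : fieldType) (c : C) (p q : {poly C}) : q != 0 ->
  fshift c (FracField.tofrac p / FracField.tofrac q) =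
  FracField.tofrac (p \Po ('X + c%:P)) / FracField.tofrac (q \Po ('X + c%:P)).
Proof.
have comp0 (u : {poly C}) : u != 0 -> u \Po ('X + c%:P) != 0.
  by move=> u0; rewrite comp_poly_eq0 // size_XaddC.
move=> q0; rewrite /fshift; set f := FracField.tofrac p / FracField.tofrac q.
have d0 : \d_(repr f) != 0 by exact: denom_ratioP.
have /eqP := frac_repr f; rewrite {1}/f eqr_div ?tofrac_eq0 // -!tofracM.
rewrite tofrac_eq => /eqP pq.
apply/eqP; rewrite eqr_div ?tofrac_eq0 ?comp0 //.
by rewrite -!tofracM -!comp_polyM -pq mulrC.
Qed.

(* Difference operators are represented by their right action on matrix valued
   rational functions; in characteristic 0 the coefficients F_j of
   sum_j eta^j F_j are determined by this action. The product "left factor first" is then [D \; E], the map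
   P |-> E (D P). *)
Definition difop (C : fieldType) (N : nat) := 'M[ratfun C]_N -> 'M[ratfun C]_N.

(* The operator eta^j F : P |-> P(x + j) F(x). *)
Definition eta (C : fieldType) (N : nat) (j : int) (F : 'M[ratfun C]_N) :
  difop C N := fun P => map_mx (fshift j%:~R) P *m F.

Definition Delta (C : fieldType) (N : nat) : difop C N :=
  eta 1 1%:M \- eta 0 1%:M.

Definition condV (C : numFieldType) (N : nat) (rho : nat -> 'M[C]_N) : Prop :=
  (exists r : 'M[ratfun C]_N, forall n : nat, ratmx_value r n%:R (rho n)) /\
  (forall x : nat, exists k : 'I_x.+1 -> nat,
     \mxblock_(i < x.+1, j < x.+1) (rho (k i) ^+ j) \in unitmx).

(* Evaluating F_1 at x and F_{-1} at 0 includes the absence of a pole there. *)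
Definition BR2 (C : numFieldType) (N : nat) (P : nat -> 'M[{poly C}]_N)
  (D : difop C N) : Prop :=
  exists F1 F0 Fm1 : 'M[ratfun C]_N,
    (forall Q, D Q = (eta 1 F1 \+ eta 0 F0 \+ eta (-1) Fm1) Q) /\
    exists Gamma : nat -> 'M[C]_N,
    [/\ forall n, D (polymx (P n)) = constmx (Gamma n) *m polymx (P n),
        forall n, evalmx (P n) 0 \in unitmx,
        exists V K : 'M[C]_N, ratmx_value Fm1 0 V /\
          forall n, invmx (evalmx (P n) 0) *m evalmx (P n) (-1) *m V = K,
        forall x : nat, exists V : 'M[C]_N,
          ratmx_value F1 x%:R V /\ V \in unitmx
      & condV (fun n => invmx (evalmx (P n) 0) *m Gamma n *m evalmx (P n) 0)].

(* The series sum_(x >= 0) P(x) W(x) Q(x)^* converges, with sum [G]. *)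
Definition inner_is (C : numClosedFieldType) (N : nat) (W : nat -> 'M[C]_N)
  (P Q : 'M[{poly C}]_N) (G : 'M[C]_N) : Prop :=
  forall i j,
    series (fun x : nat =>
      (evalmx P x%:R *m W x *m (evalmx Q x%:R)^t*) i j) @ \oo --> G i j.

Definition monic_orthogonal (C : numClosedFieldType) (N : nat)
  (W : nat -> 'M[C]_N) (P : nat -> 'M[{poly C}]_N) : Prop :=
  (forall n, monic_deg n (P n)) /\
  (forall m n, m <> n -> inner_is W (P m) (P n) 0).

(* Rows and columns are numbered from 0: the index k : 'I_N stands for k + 1. *)

Definition muA (C : numClosedFieldType) (N : nat) (mu : 'I_N -> C) : 'M[C]_N :=
  \matrix_(i, j) if i == j.+1 :> nat then mu i / mu j else 0.

Definition Jmx (C : numClosedFieldType) (N : nat) : 'M[C]_N :=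
  diag_mx (\row_k k.+1%:R).

Definition delta (C : numClosedFieldType) (a : C) (lam k : nat) : C :=
  (a / 2) ^+ lam * ((lam + k)`!)%:R / (k`!)%:R.

Definition Tmx (C : numClosedFieldType) (N : nat) (a : C) (lam : nat) :
  'M[C]_N := diag_mx (\row_(k < N) delta a lam k).

Definition Wcharlier (C : numClosedFieldType) (N : nat) (a : C)
  (mu : 'I_N -> C) (lam x : nat) : 'M[C]_N :=
  let A := muA mu in
  (a ^+ x / (x`!)%:R) *:
  ((1%:M + A) ^+ (x + lam) *m Tmx N a lam *m (1%:M + A^t*) ^+ (x + lam)).

(* (I + B)^s for nilpotent B and a polynomial exponent s = s(x), by the
   terminating binomial series sum_k binom(s, k) B^k. At integer values of the
   exponent these are the usual powers: [evalmx_unipow_nat] and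
   [evalmx_unipow_opp]. *)
Definition polybin (C : numFieldType) (k : nat) (s : {poly C}) : {poly C} :=
  ((k`!)%:R)^-1 *: \prod_(i < k) (s - (i%:R)%:P).

Definition unipow (C : numFieldType) (N : nat) (B : 'M[C]_N) (s : {poly C}) :
  'M[{poly C}]_N := \sum_(k < N) polybin k s *: map_mx polyC (B ^+ k).

Definition binr (C : numFieldType) (k : nat) (z : C) : C :=
  ((k`!)%:R)^-1 * \prod_(i < k) (z - i%:R).

Lemma binr0 (C : numFieldType) (z : C) : binr 0 z = 1.
Proof. by rewrite /binr big_ord0 fact0 invr1 mulr1. Qed.

Lemma binrS (C : numFieldType) k (z : C) :
  binr k.+1 (z + 1) = binr k.+1 z + binr k z.
Proof.
rewrite /binr big_ord_recl big_ord_recr /=.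
rewrite (eq_bigr (fun i : 'I_k => z - i%:R)) => [|i _]; last first.
  by rewrite /bump /= add1n -natr1; ring.
set p := \prod_(_ < _) _; rewrite factS natrM.
have k0 : k.+1%:R != 0 :> C by rewrite pnatr_eq0.
have f0 : (k`!)%:R != 0 :> C by rewrite pnatr_eq0 -lt0n fact_gt0.
rewrite -natr1 in k0 *; field.
by rewrite f0 k0.
Qed.

Lemma evalmx_unipow (C : numFieldType) (N : nat) (B : 'M[C]_N) s x :
  evalmx (unipow B s) x = \sum_(k < N) binr k s.[x] *: B ^+ k.
Proof.
apply/matrixP => i j; rewrite mxE !summxE horner_sum; apply: eq_bigr => k _.
rewrite !mxE hornerM hornerC hornerZ horner_prod; congr (_ * _ * _).
by apply: eq_bigr => l _; rewrite hornerD hornerN hornerC.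
Qed.

Lemma unipow_binrS (C : numFieldType) (N : nat) (B : 'M[C]_N) z :
  B ^+ N = 0 ->
  \sum_(k < N) binr k (z + 1) *: B ^+ k =
  (1%:M + B) *m \sum_(k < N) binr k z *: B ^+ k.
Proof.
case: N B => [|N] B BN; first by apply/matrixP => - [].
rewrite mulmxDl mul1mx mulmx_sumr [X in _ = _ + X]big_ord_recr /=.
rewrite -scalemxAr -[B *m B ^+ N]exprS BN scaler0 addr0.
rewrite big_ord_recl [X in _ = X + _]big_ord_recl /= !binr0 -addrA.
congr (_ + _); rewrite -big_split /=; apply: eq_bigr => k _.
by rewrite /bump /= add1n binrS scalerDl -scalemxAr -[B *m B ^+ k]exprS.
Qed.

Lemma unipow_binr0 (C : numFieldType) (N : nat) (B : 'M[C]_N) :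
  \sum_(k < N) binr k (0 : C) *: B ^+ k = 1%:M.
Proof.
case: N B => [|N] B; first by apply/matrixP => - [].
rewrite big_ord_recl /= binr0 scale1r expr0 big1 ?addr0 // => k _.
by rewrite /binr big_ord_recl subrr mul0r mulr0 scale0r.
Qed.

Lemma evalmx_unipow_nat (C : numFieldType) (N : nat) (B : 'M[C]_N) s x n :
  B ^+ N = 0 -> s.[x] = n%:R -> evalmx (unipow B s) x = (1%:M + B) ^+ n.
Proof.
move=> BN sx; rewrite evalmx_unipow sx; elim: n {sx} => [|n IHn].
  by rewrite unipow_binr0.
by rewrite -natr1 unipow_binrS // IHn exprS.
Qed.

Lemma evalmx_unipow_opp (C : numFieldType) (N : nat) (B : 'M[C]_N) s x n :
  B ^+ N = 0 -> s.[x] = - n%:R ->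
  evalmx (unipow B s) x = invmx ((1%:M + B) ^+ n).
Proof.
move=> BN sx; rewrite evalmx_unipow sx {sx}; set U := \sum_(_ < _) _.
suff UE : (1%:M + B) ^+ n *m U = 1%:M.
  have [uB _] := mulmx1_unit UE.
  by rewrite -[U](mulKmx uB) UE mulmx1.
rewrite {}/U; elim: n => [|n IHn].
  by rewrite expr0 oppr0 unipow_binr0 mulmx1.
by rewrite exprSr -mulmxA -unipow_binrS // -natr1 opprD addrNK.
Qed.

Lemma muA_nilp (C : numClosedFieldType) (N : nat) (mu : 'I_N -> C) :
  muA mu ^+ N = 0.
Proof.
have H k : forall i j : 'I_N, (i < j + k)%N -> (muA mu ^+ k) i j = 0.
  elim: k => [|k IHk] i j ltij.
    by rewrite addn0 in ltij; rewrite expr0 mxE -val_eqE /= (ltn_eqF ltij).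
  rewrite exprS mxE big1 // => l _; rewrite mxE.
  case: eqP => [il|_]; last by rewrite mul0r.
  by rewrite IHk ?mulr0 // -ltnS -il -addnS.
by apply/matrixP => i j; rewrite [RHS]mxE H // ltn_addl.
Qed.

(* The matrix polynomial Phi(x)^*; see [PhiS_nat] for its values on N_0. *)
Definition PhiS (C : numClosedFieldType) (N : nat) (a : C) (mu : 'I_N -> C)
  (lam : nat) : 'M[{poly C}]_N :=
  let A := muA mu in
  (a / 2)%:P *:
  (unipow A ('X + (lam.+1%:R)%:P)
   *m map_mx polyC (Jmx C N *m (1%:M + A^t*) + lam%:R *: 1%:M)
   *m unipow A (- 'X - (lam%:R)%:P)).

Lemma evalmxM (C : fieldType) (N : nat) (P Q : 'M[{poly C}]_N) x :
  evalmx (P *m Q) x = evalmx P x *m evalmx Q x.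
Proof. exact: (map_mxM (horner_eval x)). Qed.

Lemma evalmxZ (C : fieldType) (N : nat) (p : {poly C}) (Q : 'M[{poly C}]_N) x :
  evalmx (p *: Q) x = p.[x] *: evalmx Q x.
Proof. exact: (map_mxZ (horner_eval x)). Qed.

Lemma evalmxC (C : fieldType) (N : nat) (M : 'M[C]_N) x :
  evalmx (map_mx polyC M) x = M.
Proof. by apply/matrixP => i j; rewrite !mxE hornerC. Qed.

Lemma PhiS_nat (C : numClosedFieldType) (N : nat) (a : C) (mu : 'I_N -> C)
  (lam x : nat) : let A := muA mu in
  evalmx (PhiS a mu lam) x%:R =
  (a / 2) *: ((1%:M + A) ^+ (x + lam + 1)
              *m (Jmx C N *m (1%:M + A^t*) + lam%:R *: 1%:M)
              *m invmx ((1%:M + A) ^+ (x + lam))).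
Proof.
rewrite /PhiS evalmxZ hornerC !evalmxM evalmxC.
rewrite (evalmx_unipow_nat (n := x + lam + 1)) ?muA_nilp //; last first.
  by rewrite !hornerE -natrD addn1 addnS.
by rewrite (evalmx_unipow_opp (n := x + lam)) ?muA_nilp // !hornerE -opprD natrD.
Qed.

(* The matrix polynomial Phi(x)^* - Psi(x)^*; see [PhiPsiS_nat]. *)
Definition PhiPsiS (C : numClosedFieldType) (N : nat) (mu : 'I_N -> C)
  (lam : nat) : 'M[{poly C}]_N :=
  let A := muA mu in
  (2^-1 *: 'X) *:
  (unipow A ('X + (lam%:R)%:P)
   *m map_mx polyC (Jmx C N + lam%:R *: 1%:M)
   *m unipow A (- 'X - (lam%:R)%:P)).

Lemma PhiPsiS_nat (C : numClosedFieldType) (N : nat) (mu : 'I_N -> C)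
  (lam x : nat) : let A := muA mu in
  evalmx (PhiPsiS mu lam) x%:R =
  (x%:R / 2) *: ((1%:M + A) ^+ (x + lam)
                 *m (Jmx C N + lam%:R *: 1%:M)
                 *m invmx ((1%:M + A) ^+ (x + lam))).
Proof.
rewrite /PhiPsiS evalmxZ !evalmxM evalmxC !hornerE mulrC.
rewrite (evalmx_unipow_nat (n := x + lam)) ?muA_nilp //; last first.
  by rewrite !hornerE natrD.
by rewrite (evalmx_unipow_opp (n := x + lam)) ?muA_nilp // !hornerE -opprD natrD.
Qed.

Definition Sop (C : numClosedFieldType) (N : nat) (a : C) (mu : 'I_N -> C)
  (lam : nat) : difop C N :=
  eta 0 (- polymx (PhiS a mu lam)) \+ eta (-1) (polymx (PhiPsiS mu lam)).

Definition Dop (C : numClosedFieldType) (N : nat) (a : C) (mu : 'I_N -> C)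
  (lam : nat) : difop C N :=
  let IA := 1%:M + muA mu in
  eta 1 (constmx (a *: IA))
  \- eta 0 (constmx (Jmx C N))
  \- eta 0 (polymx (('X + (lam%:R)%:P) *: map_mx polyC (invmx IA)))
  \+ eta (-1) (polymx ('X *: map_mx polyC (invmx IA))).

(* Main.v *)
From HB Require Import structures.
Require Import Defs.
From mathcomp Require Import all_boot all_order all_algebra ring.
From mathcomp Require Import complex.
From mathcomp Require Import boolp classical_sets reals topology normedtype
  sequences.

(** Write U = I + A, V for its inverse, Us for its adjoint, and let W(x) be the
    matrix polynomial U^(x+lam) T Us^(x+lam), so that the weight is
    a^x / x! W(x). The three operators have the form
      P |-> P(x+1) F1(x) + P(x) F0(x) + P(x-1) x G(x)
    with matrix polynomials F1, F0, G. The factor x in the last coefficient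
    already makes the condition on P_n(-1) trivial.

    Eigenfunctions. For a polynomial p, the sum of x p(x-1) a^x / x! is a times
    the sum of p(x) a^x / x!. Hence the operator is symmetric for the inner
    product once F0 W is Hermitian and F1(x) W(x) is a times the adjoint of
    G(x+1) W(x+1) ([polyop_adjoint]). These identities are checked at natural
    x, where they follow from [J, A] = A, from the recurrence satisfied by the
    entries of T, and from A^* A being diagonal. If a symmetric operator also
    maps polynomials of degree at most n with leading coefficient M to
    polynomials of degree at most n with leading coefficient M Gamma_n, then
    P_n D - Gamma_n P_n has degree below n and is orthogonal to itself, so it
    vanishes ([symmetric_eigen]). The operators Delta S and S Delta preserve
    degrees because Phi(x) - x G(x) is of degree one in x ([Phi_decomp]), a
    consequence of the sl2 type commutation relation between J A^* and A
    ([B_A]). Their eigenvalue matrices turn out to be n/2 (Gamma_n + c_n) and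
    (n+1)/2 (Gamma_n + c_n - 1), where Gamma_n = a U - J - (n + lam) V is that
    of the first operator and c_n is a scalar.

    Values at zero. At x = 0 the eigenvalue equations involve only P_n(0) and
    P_n(1). Eliminating P_n(1) between the equations of the first two operators
    gives, with S = U^lam and Z = J Us + lam,
      Gamma_n P_n(0) = P_n(0) S (theta_n - c_n) S^-1,
      theta_n = (L + n) Z (Z + n)^-1
    ([GammaD_theta]). So Gamma_n P_n(0) factors through P_n(0), and the three
    term recurrence in x propagates the left kernel of P_n(0) to every P_n(x);
    since P_n is monic this kernel is trivial ([eval0_unit]).

    Condition (V). Consequently each rho(n) is conjugate under S to
    (al1 n + be1) theta_n + (al2 n + be2) for scalars al1, be1, al2, be2. It is
    a rational function of n, and rho(n) / n tends to a conjugate of the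
    invertible matrix al1 Z + al2. For the nodes k_i = (i + 1) t the rescaled
    block Vandermonde matrix is a rational function of 1 / t which is
    invertible at 0, hence at some 1 / t ([condV_exists]). *)

Set Implicit Arguments.
Unset Strict Implicit.
Unset Printing Implicit Defensive.

Import Order.TTheory GRing.Theory Num.Theory.
Import numFieldNormedType.Exports.
Local Open Scope ring_scope.
Local Open Scope sesquilinear_scope.
Local Open Scope classical_set_scope.

(** * Matrix calculus *)

Section EntrywiseLinear.
Variables (K : pzRingType) (m n : nat).
Lemma mxDE (A B : 'M[K]_(m, n)) i j : (A + B) i j = A i j + B i j.
Proof. by rewrite mxE. Qed.
Lemma mxNE (A : 'M[K]_(m, n)) i j : (- A) i j = - A i j.
Proof. by rewrite mxE. Qed.
Lemma mxZE c (A : 'M[K]_(m, n)) i j : (c *: A) i j = c * A i j.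
Proof. by rewrite mxE. Qed.
Lemma mx0E i j : (0 : 'M[K]_(m, n)) i j = 0.
Proof. by rewrite mxE. Qed.
Definition mxlinE := (mxDE, mxNE, mxZE, mx0E).
End EntrywiseLinear.

(** Identities that are linear in matrix products hold entrywise as identities
    of a commutative ring or field, in which every product is an atom. *)
Ltac mxring := apply/matrixP => ? ?; rewrite ?mxlinE; ring.
Ltac mxfield := apply/matrixP => ? ?; rewrite ?mxlinE; field; try by [].

Section MxNorm.
Variables (K : comPzRingType) (n : nat).
Implicit Types A B D : 'M[K]_n.
Lemma scalemx_mull c A B : (c *: A) *m B = c *: (A *m B).
Proof. by rewrite scalemxAl. Qed.
Lemma scalemx_mulr c A B : A *m (c *: B) = c *: (A *m B).
Proof. by rewrite scalemxAr. Qed.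
(** Expands an expression into a linear combination of flattened products, the
    form in which [mxring] compares both sides. *)
Definition mxnorm := (@mulmxDl K n n n, @mulmxDr K n n n, @mulNmx K n n n,
  @mulmxN K n n n,
  scalemx_mull, scalemx_mulr, @mul1mx K n n, @mulmx1 K n n, @mulmxA K n n n n).
Lemma expmxS A k : A ^+ k.+1 = A *m A ^+ k.
Proof. by rewrite exprS. Qed.
Lemma expmxSr A k : A ^+ k.+1 = A ^+ k *m A.
Proof. by rewrite exprSr. Qed.
Lemma expmxZ c A k : (c *: A) ^+ k = c ^+ k *: A ^+ k.
Proof.
elim: k => [|k IHk]; first by rewrite !expr0 scale1r.
by rewrite !expmxS IHk -scalemxAl -scalemxAr scalerA -exprS.
Qed.
End MxNorm.

Lemma unitmx_rcancel (K : comUnitRingType) n (A B D : 'M[K]_n) :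
  D \in unitmx -> A *m D = B *m D -> A = B.
Proof. by move=> Du AB; rewrite -[A](mulmxK Du) AB mulmxK. Qed.

Section Adjoint.
Variables (C : numClosedFieldType) (n : nat).
Implicit Types A B : 'M[C]_n.
Lemma adjM A B : (A *m B)^t* = B^t* *m A^t*.
Proof. by rewrite trmx_mul map_mxM. Qed.
Lemma adjD A B : (A + B)^t* = A^t* + B^t*.
Proof. by rewrite linearD map_mxD. Qed.
Lemma adjZ c A : (c *: A)^t* = c^* *: A^t*.
Proof. by rewrite linearZ map_mxZ. Qed.
Lemma adj1 : (1%:M : 'M[C]_n)^t* = 1%:M.
Proof. by rewrite trmx1 map_mx1. Qed.
Lemma adjX A k : (A ^+ k)^t* = (A^t*) ^+ k.
Proof.
elim: k => [|k IHk]; first by rewrite !expr0 adj1.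
by rewrite expmxS adjM IHk expmxSr.
Qed.
End Adjoint.

(** * Shifts of rational functions *)

Section Shift.
Variables (C : fieldType) (c : C).
Local Notation frac := (@FracField.tofrac {poly C}).

Lemma ratfunP (f : ratfun C) :
  exists p q : {poly C}, q != 0 /\ f = frac p / frac q.
Proof.
exists \n_(repr f), \d_(repr f); split; [exact: denom_ratioP|exact: frac_repr].
Qed.

Lemma comp_XaddC_eq0 (p : {poly C}) : (p \Po ('X + c%:P) == 0) = (p == 0).
Proof. by rewrite comp_poly_eq0 // size_XaddC. Qed.

Lemma fshift_tofrac (p : {poly C}) :
  fshift c (frac p) = frac (p \Po ('X + c%:P)).
Proof.
have := fshiftE c p (oner_neq0 _).
by rewrite comp_polyC !tofrac1 !divr1.
Qed.

Lemma fshift_is_zmod_morphism : zmod_morphism (fshift c).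
Proof.
move=> f g; have [p [q [q0 ->]]] := ratfunP f.
have [u [v [v0 ->]]] := ratfunP g.
rewrite -mulNr -tofracN addf_div ?tofrac_eq0 // -!tofracM -tofracD.
rewrite !fshiftE ?mulf_neq0 // comp_polyD !comp_polyM rmorphN /=.
by rewrite -[in RHS]mulNr -tofracN addf_div ?tofrac_eq0 ?comp_XaddC_eq0 //
  -!tofracM -tofracD.
Qed.

Lemma fshift_is_monoid_morphism : monoid_morphism (fshift c).
Proof.
split=> [|f g]; first by rewrite -tofrac1 fshift_tofrac comp_polyC.
have [p [q [q0 ->]]] := ratfunP f; have [u [v [v0 ->]]] := ratfunP g.
rewrite mulf_div -!tofracM !fshiftE ?mulf_neq0 // !comp_polyM.
by rewrite mulf_div -!tofracM.
Qed.

HB.instance Definition _ :=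
  GRing.isZmodMorphism.Build _ _ (fshift c) fshift_is_zmod_morphism.
HB.instance Definition _ :=
  GRing.isMonoidMorphism.Build _ _ (fshift c) fshift_is_monoid_morphism.
End Shift.

Lemma fshiftD (C : fieldType) (c d : C) f :
  fshift c (fshift d f) = fshift (d + c) f.
Proof.
have [p [q [q0 ->]]] := ratfunP f.
rewrite (fshiftE d) // (fshiftE c) ?comp_XaddC_eq0 // (fshiftE (d + c)) //.
have E (u : {poly C}) : (u \Po ('X + d%:P)) \Po ('X + c%:P) =
  u \Po ('X + (d + c)%:P).
  by rewrite -comp_polyA comp_polyD comp_polyX comp_polyC polyCD -addrA
    [c%:P + _]addrC.
by rewrite !E.
Qed.

Lemma fshift0 (C : fieldType) (f : ratfun C) : fshift 0 f = f.
Proof.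
have [p [q [q0 ->]]] := ratfunP f.
by rewrite !fshiftE // addr0 !comp_polyXr.
Qed.

(** * Polynomial matrices and their difference operators *)

Section EvalMx.
Variables (C : fieldType) (N : nat).
Implicit Types (P Q : 'M[{poly C}]_N).
Lemma evalmxD P Q x : evalmx (P + Q) x = evalmx P x + evalmx Q x.
Proof. by apply/matrixP => i j; rewrite !mxE hornerD. Qed.
Lemma evalmxN P x : evalmx (- P) x = - evalmx P x.
Proof. by apply/matrixP => i j; rewrite !mxE hornerN. Qed.
Lemma evalmx1 x : evalmx (1%:M : 'M[{poly C}]_N) x = 1%:M.
Proof. by apply/matrixP => i k; rewrite !mxE hornerMn hornerC. Qed.
Lemma evalmxX (P : 'M[{poly C}]_N) j x : evalmx (P ^+ j) x = evalmx P x ^+ j.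
Proof.
elim: j => [|j IHj]; last by rewrite !exprS evalmxM IHj.
by rewrite !expr0; apply/matrixP => i k; rewrite !mxE hornerMn hornerC.
Qed.
Lemma adj_evalmx (P : 'M[{poly C}]_N) x : evalmx (\adj P) x = \adj (evalmx P x).
Proof. exact: (map_mx_adj (horner_eval x)). Qed.
Lemma det_evalmx (P : 'M[{poly C}]_N) x : (\det P).[x] = \det (evalmx P x).
Proof. exact: (esym (det_map_mx (horner_eval x) P)). Qed.
End EvalMx.

Section PolyMx.
Variables (C : numFieldType) (N : nat).
Implicit Types P Q F G : 'M[{poly C}]_N.

Lemma polymxM P Q : polymx (P *m Q) = polymx P *m polymx Q.
Proof. exact: map_mxM. Qed.
Lemma polymxD P Q : polymx (P + Q) = polymx P + polymx Q.
Proof. exact: map_mxD. Qed.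
Lemma polymxN P : polymx (- P) = - polymx P.
Proof. exact: map_mxN. Qed.

Definition pshift (c : C) P : 'M[{poly C}]_N :=
  map_mx (comp_poly ('X + c%:P)) P.

Lemma pshiftM c P Q : pshift c (P *m Q) = pshift c P *m pshift c Q.
Proof. exact: map_mxM. Qed.
Lemma pshiftD c P Q : pshift c (P + Q) = pshift c P + pshift c Q.
Proof. exact: map_mxD. Qed.
Lemma pshiftN c P : pshift c (- P) = - pshift c P.
Proof. exact: map_mxN. Qed.

Lemma fshift_polymx c P : map_mx (fshift c) (polymx P) = polymx (pshift c P).
Proof. by apply/matrixP => i j; rewrite !mxE fshift_tofrac. Qed.

Definition polyop F1 F0 G P : 'M[{poly C}]_N :=
  pshift 1 P *m F1 + P *m F0 + pshift (-1) P *m G.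

Definition difop_of F1 F0 G : difop C N :=
  eta 1 (polymx F1) \+ eta 0 (polymx F0) \+ eta (-1) (polymx G).

Lemma map_fshift0 (X : 'M[ratfun C]_N) : map_mx (fshift 0) X = X.
Proof. by apply/matrixP => i j; rewrite mxE fshift0. Qed.

Lemma map_fshiftD (c d : C) (X : 'M[ratfun C]_N) :
  map_mx (fshift c) (map_mx (fshift d) X) = map_mx (fshift (d + c)) X.
Proof. by apply/matrixP => i j; rewrite !mxE fshiftD. Qed.

Lemma difop_ofE F1 F0 G P :
  difop_of F1 F0 G (polymx P) = polymx (polyop F1 F0 G P).
Proof.
rewrite /difop_of /= /eta mulr0z mulr1z mulrN1z map_fshift0 !fshift_polymx.
by rewrite /polyop !polymxD !polymxM.
Qed.

(** In the product of these two first order operators the shifts by 1 and -1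
    cancel, so that three coefficients remain. *)
Lemma Delta_comp_difop F G (X : 'M[ratfun C]_N) :
  (@Delta C N \; (eta 0 (- polymx F) \+ eta (-1) (polymx G))) X =
  difop_of (- F) (F + G) (- G) X.
Proof.
rewrite /Delta /difop_of /eta /= !mulmx1 mulr0z mulr1z mulrN1z !map_fshift0.
rewrite map_mxB map_fshiftD subrr map_fshift0 !polymxN polymxD.
by rewrite mulmxDr !mulmxN !mulmxBl opprB [X in X + _]addrC !addrA.
Qed.

Lemma difop_comp_Delta F G (X : 'M[ratfun C]_N) :
  ((eta 0 (- polymx F) \+ eta (-1) (polymx G)) \; @Delta C N) X =
  difop_of (- pshift 1 F) (F + pshift 1 G) (- G) X.
Proof.
rewrite /Delta /difop_of /eta /= !mulmx1 mulr0z mulr1z mulrN1z !map_fshift0.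
rewrite map_mxD !map_mxM map_fshiftD addNr map_fshift0 map_mxN.
rewrite !fshift_polymx !polymxN polymxD mulmxDr !mulmxN.
by rewrite opprD opprK addrACA !addrA.
Qed.
End PolyMx.

Section PolyMxShift.
Variables (C : numFieldType) (N : nat).
Implicit Types (P Q : 'M[{poly C}]_N) (M : 'M[C]_N).

Lemma pshiftDc c d P : pshift c (pshift d P) = pshift (d + c) P.
Proof.
apply/matrixP => i j; rewrite !mxE -comp_polyA comp_polyD comp_polyX comp_polyC.
by rewrite polyCD -addrA [c%:P + _]addrC.
Qed.
Lemma pshift0 P : pshift 0 P = P.
Proof. by apply/matrixP => i j; rewrite !mxE addr0 comp_polyXr. Qed.
Lemma pshiftK c P : pshift (- c) (pshift c P) = P.
Proof. by rewrite pshiftDc subrr pshift0. Qed.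
Lemma pshiftNK c P : pshift c (pshift (- c) P) = P.
Proof. by rewrite pshiftDc addNr pshift0. Qed.
Lemma evalmx_shift c P x : evalmx (pshift c P) x = evalmx P (x + c).
Proof. by apply/matrixP => i j; rewrite !mxE horner_comp !hornerE. Qed.

Lemma pshiftZX c P :
  pshift c ('X *: P) = ('X + c%:P) *: pshift c P.
Proof. by apply/matrixP => i j; rewrite !mxE comp_polyM comp_polyX. Qed.

Lemma poly_nat_inj (p q : {poly C}) :
  (forall x : nat, p.[x%:R] = q.[x%:R]) -> p = q.
Proof.
move=> pq; apply/eqP; rewrite -subr_eq0; apply/eqP.
apply: (@roots_geq_poly_eq0 _ _ [seq i%:R | i <- iota 0 (size (p - q))]).
- by apply/allP => _ /mapP[i _ ->]; rewrite rootE !hornerE pq subrr.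
- by rewrite map_inj_uniq ?iota_uniq // => i j /eqP; rewrite eqr_nat => /eqP.
- by rewrite size_map size_iota.
Qed.

(** Matrix polynomials are compared on the naturals, where the binomial series
    for U^(x + l) are genuine powers of U. *)
Lemma evalmx_nat_inj P Q :
  (forall x : nat, evalmx P x%:R = evalmx Q x%:R) -> P = Q.
Proof.
move=> PQ; apply/matrixP => i j; apply: poly_nat_inj => x.
by have /matrixP/(_ i j) := PQ x; rewrite !mxE.
Qed.
End PolyMxShift.

Section Star.
Variables (C : numClosedFieldType) (N : nat).
Implicit Types (P Q : 'M[{poly C}]_N) (M : 'M[C]_N).
Local Notation CM M := (map_mx (@polyC C) M).

(** The adjoint on coefficients: a matrix polynomial again, with the adjoint
    values at real points by [evalmx_pstar]. *)
Definition pstar P : 'M[{poly C}]_N := (map_mx (map_poly Num.conj) P)^T.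

Lemma pstarM P Q : pstar (P *m Q) = pstar Q *m pstar P.
Proof. by rewrite /pstar map_mxM trmx_mul. Qed.
Lemma pstarD P Q : pstar (P + Q) = pstar P + pstar Q.
Proof. by rewrite /pstar map_mxD linearD. Qed.
Lemma pstarC M : pstar (CM M) = CM (M^t*).
Proof. by apply/matrixP => i j; rewrite !mxE map_polyC. Qed.
Lemma pstarZ p P : pstar (p *: P) = map_poly Num.conj p *: pstar P.
Proof. by apply/matrixP => i j; rewrite !mxE rmorphM. Qed.
Lemma pstarX P : pstar ('X *: P) = 'X *: pstar P.
Proof. by rewrite pstarZ map_polyX. Qed.
Lemma pstarK : involutive pstar.
Proof.
move=> P; apply/matrixP => i j; rewrite !mxE -map_poly_comp ?rmorph0 //.
by rewrite map_poly_id // => c _ /=; rewrite conjCK.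
Qed.
Lemma pstar_shift c P : pstar (pshift c P) = pshift c^* (pstar P).
Proof.
apply/matrixP => i j; rewrite !mxE map_comp_poly; congr (_ \Po _).
by rewrite rmorphD /= map_polyX map_polyC.
Qed.
Lemma evalmx_pstar P (x : C) : x \is Num.real ->
  evalmx (pstar P) x = (evalmx P x)^t*.
Proof.
move=> xR; apply/matrixP => i j; rewrite !mxE -{1}(CrealP xR).
by rewrite horner_map.
Qed.
End Star.

(** * Degrees and leading coefficients *)

Section Lead.
Variables (C : numFieldType) (N : nat).
Implicit Types (P Q : 'M[{poly C}]_N) (M : 'M[C]_N).
Local Notation CM M := (map_mx (@polyC C) M).

Definition size_le n P := forall i j, (size (P i j) <= n)%N.

(** The matrix M may be singular or zero, so that the predicate is stable under
    sums and products. *)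
Definition lead n P M := size_le n.+1 P /\ map_mx (coefp n) P = M.

Lemma size_le_lead n P : size_le n.+1 P -> lead n P (map_mx (coefp n) P).
Proof. by []. Qed.

Lemma size_le_leadS n P : size_le n P -> lead n P 0.
Proof.
move=> s; split=> [i j|]; first exact: leq_trans (s i j) _.
by apply/matrixP => i j; rewrite !mxE /= nth_default.
Qed.

Lemma lead0_size_le n P : lead n P 0 -> size_le n P.
Proof.
case=> sP P0 i j; apply/leq_sizeP => k; rewrite leq_eqVlt => /predU1P[<-|nk].
  by have /matrixP/(_ i j) := P0; rewrite !mxE /=.
by rewrite nth_default // (leq_trans (sP i j)).
Qed.

Lemma monic_deg_lead n P : monic_deg n P -> lead n P 1%:M.
Proof.
case=> P1 Pk; split=> // i j; apply/leq_sizeP => k nk.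
by have /matrixP/(_ i j) := Pk k nk; rewrite !mxE.
Qed.

Lemma leadD n P Q M M' : lead n P M -> lead n Q M' -> lead n (P + Q) (M + M').
Proof.
move=> [sP <-] [sQ <-]; split=> [i j|]; last by rewrite map_mxD.
by rewrite mxE (leq_trans (size_polyD _ _)) // geq_max sP sQ.
Qed.

Lemma leadN n P M : lead n P M -> lead n (- P) (- M).
Proof.
move=> [sP <-]; split=> [i j|]; last by rewrite map_mxN.
by rewrite mxE size_polyN.
Qed.

Lemma leadB n P Q M M' : lead n P M -> lead n Q M' -> lead n (P - Q) (M - M').
Proof. by move=> ? ?; apply/leadD/leadN. Qed.

Lemma leadMC n P M K : lead n P M -> lead n (P *m CM K) (M *m K).
Proof.
move=> [sP <-]; split=> [i j|].
  rewrite mxE (leq_trans (size_sum _ _ _)) //; apply/bigmax_leqP => k _.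
  by rewrite mxE mulrC mul_polyC (leq_trans (size_scale_leq _ _)).
apply/matrixP => i j; rewrite !mxE /= coef_sum; apply: eq_bigr => k _.
by rewrite !mxE coefMC.
Qed.

Lemma leadCM n P M K : lead n P M -> lead n (CM K *m P) (K *m M).
Proof.
move=> [sP <-]; split=> [i j|].
  rewrite mxE (leq_trans (size_sum _ _ _)) //; apply/bigmax_leqP => k _.
  by rewrite mxE mul_polyC (leq_trans (size_scale_leq _ _)).
apply/matrixP => i j; rewrite !mxE /= coef_sum; apply: eq_bigr => k _.
by rewrite !mxE coefCM.
Qed.

Lemma leadX n P M : lead n P M -> lead n.+1 ('X *: P) M.
Proof.
move=> [sP <-]; split=> [i j|]; last first.
  by apply/matrixP => i j; rewrite !mxE /= coefXM.
rewrite mxE; have [->|P0] := eqVneq (P i j) 0;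
  first by rewrite mulr0 size_poly0.
by rewrite mulrC size_mulX // ltnS sP.
Qed.

Lemma leadS n P M : lead n P M -> lead n.+1 P 0.
Proof. by move=> [sP _]; exact: size_le_leadS. Qed.

(** The factor x compensates the drop of the degree under a difference, which
    treats constants uniformly; the induction writes p = q x + d. *)
Lemma sizeX_diff c n (p : {poly C}) : (size p <= n.+1)%N ->
  (size ('X * (p \Po ('X + c%:P) - p))%R <= n.+1)%N /\
  ('X * (p \Po ('X + c%:P) - p))`_n = c * n%:R * p`_n.
Proof.
elim: n p => [|n IHn] p sp.
  split; last by rewrite coefXM eqxx mulr0 mul0r.
  by rewrite (size1_polyC sp) comp_polyC subrr mulr0 size_poly0.
elim/poly_ind: p sp => [|q d _] sp.
  by rewrite comp_poly0 subrr mulr0 size_poly0 coef0 mulr0.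
have sq : (size q <= n.+1)%N.
  move: sp; rewrite size_MXaddC.
  by case: ifP => // /andP[/eqP-> _] _; rewrite size_poly0.
have [sD cD] := IHn q sq.
set D := q \Po _ - q in sD cD.
have -> : (q * 'X + d%:P) \Po ('X + c%:P) - (q * 'X + d%:P) =
    'X * D + c *: (q + D).
  rewrite /D comp_polyD comp_polyM comp_polyX comp_polyC -mul_polyC; ring.
have sDn : (size D <= n)%N.
  have [->|D0] := eqVneq D 0; first by rewrite size_poly0.
  by move: sD; rewrite mulrC size_mulX.
split.
  rewrite mulrC (leq_trans (size_polyMleq _ _)) // size_polyX addn2 /= ltnS.
  rewrite (leq_trans (size_polyD _ _)) // geq_max sD.
  rewrite (leq_trans (size_scale_leq _ _)) // (leq_trans (size_polyD _ _)) //.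
  by rewrite geq_max sq (leq_trans sDn).
rewrite coefXM /= coefD cD coefZ coefD (nth_default 0 sDn) addr0.
rewrite coefD coefMX /= coefC /= addr0 -natr1; ring.
Qed.

Lemma leadX_diff c n P M : lead n P M ->
  lead n ('X *: (pshift c P - P)) ((c * n%:R) *: M).
Proof.
move=> [sP <-]; split=> [i j|].
  by rewrite !mxE; have [] := sizeX_diff c (sP i j).
by apply/matrixP => i j; rewrite !mxE /=; have [] := sizeX_diff c (sP i j).
Qed.

Lemma lead_diffS c n P M : lead n.+1 P M ->
  lead n (pshift c P - P) ((c * n.+1%:R) *: M).
Proof.
move=> /(leadX_diff c)[sD <-]; split=> [i j|]; last first.
  by apply/matrixP => i j; rewrite !mxE /= coefXM.
have := sD i j; rewrite mxE; set D := _ i j.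
have [->|D0] := eqVneq D 0; first by rewrite size_poly0.
by rewrite mulrC size_mulX.
Qed.

Lemma lead_diff c n P M : lead n P M -> lead n (pshift c P - P) 0.
Proof. by move=> /leadS/(lead_diffS c); rewrite scaler0. Qed.

Lemma lead_shift c n P M : lead n P M -> lead n (pshift c P) M.
Proof.
move=> PM; have := leadD (lead_diff c PM) PM.
by rewrite subrK add0r.
Qed.

Lemma lead_eq n Q M M' : M = M' -> lead n Q M -> lead n Q M'.
Proof. by move=> ->. Qed.

(** With R = x (Q(x) - Q(x-1)), the polynomial is x (R(x+1) - R(x)) minus
    x (Q(x+1) - Q(x)), and [leadX_diff] gives n * n - n. *)
Lemma lead_diff2 n Q M : lead n Q M ->
  lead n ('X *: ('X *: (pshift 1 Q - Q - (Q - pshift (-1) Q))))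
    ((n%:R * (n%:R - 1)) *: M).
Proof.
move=> QM; set R := 'X *: (Q - pshift (-1) Q).
have RM : lead n R (n%:R *: M).
  have := leadN (leadX_diff (-1) QM); rewrite -scalerN opprB; apply: lead_eq.
  mxring.
have -> : 'X *: ('X *: (pshift 1 Q - Q - (Q - pshift (-1) Q))) =
    'X *: (pshift 1 R - R) - 'X *: (pshift 1 Q - Q).
  rewrite /R pshiftZX pshiftD pshiftN pshiftNK; mxring.
have := leadB (leadX_diff 1 RM) (leadX_diff 1 QM).
apply: lead_eq; mxring.
Qed.
End Lead.

(** * Summation against the Charlier weight *)

Section CharlierSum.
Variables (C : numClosedFieldType) (a : C).
Implicit Types p q : {poly C}.

Definition charlier_term p (x : nat) : C := a ^+ x / (x`!)%:R * p.[x%:R].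

Lemma charlier_termD p q :
  charlier_term (p + q) = charlier_term p \+ charlier_term q.
Proof. by apply/funext => x; rewrite /charlier_term hornerD mulrDr. Qed.

Lemma charlier_termZ c p :
  charlier_term (c *: p) = c \*: charlier_term p.
Proof. by apply/funext => x; rewrite /charlier_term hornerZ mulrCA. Qed.

(** Summation by parts for the Charlier weight: the factor x cancels against
    x! and removes the term at 0. *)
Lemma series_charlier_shift p (n : nat) :
  series (charlier_term ('X * (p \Po ('X + (-1)%:P)))) n.+1 =
  a * series (charlier_term p) n.
Proof.
rewrite /series /= big_nat_recl //
  {1}/charlier_term hornerM hornerX mul0r mulr0 add0r.
rewrite mulr_sumr; apply: eq_bigr => i _.
rewrite /charlier_term hornerM hornerX horner_comp !hornerE -{2}natr1 addrK.
rewrite exprS factS natrM.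
have k0 : i.+1%:R != 0 :> C by rewrite pnatr_eq0.
have f0 : (i`!)%:R != 0 :> C by rewrite pnatr_eq0 -lt0n fact_gt0.
rewrite /= -natr1 in k0 *; field.
by apply/andP.
Qed.

Lemma cvg_charlier_shift p l :
  series (charlier_term p) @ \oo --> l ->
  series (charlier_term ('X * (p \Po ('X + (-1)%:P)))) @ \oo --> a * l.
Proof.
move=> pl; rewrite -cvg_shiftS.
under eq_fun do rewrite series_charlier_shift.
by apply: cvgM => //; exact: cvg_cst.
Qed.

Hypothesis cvg1 : cvgn (series (charlier_term 1)).

(** By induction on the degree: for p = q x + c, the product x q(x) is of the
    form x r(x - 1) with r(x) = q(x + 1) of smaller degree, so that everything
    reduces to the exponential series. *)
Lemma cvg_charlier p : cvgn (series (charlier_term p)).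
Proof.
have [n] := ubnP (size p); elim: n p => [//|n IHn] p.
rewrite ltnS => sp.
elim/poly_ind: p sp => [|q c _] sp.
  rewrite -(scale0r 1) charlier_termZ; exact: is_cvg_seriesZ.
have -> : q * 'X + c%:P = 'X * ((q \Po ('X + 1%:P)) \Po ('X + (-1)%:P)) + c
  *: 1.
  rewrite -comp_polyA comp_polyD comp_polyX comp_polyC -addrA -polyCD addNr.
  by rewrite addr0 comp_polyXr mulrC alg_polyC.
rewrite charlier_termD charlier_termZ seriesD.
apply: is_cvgD; last exact: is_cvg_seriesZ.
have [q0|q0] := eqVneq q 0.
  rewrite q0 !comp_poly0 mulr0 -(scale0r 1) charlier_termZ.
  exact: is_cvg_seriesZ.
suff /cvg_ex[l lE] : cvgn (series (charlier_term (q \Po ('X + 1%:P)))).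
  by apply/cvg_ex; exists (a * l); exact: cvg_charlier_shift.
by apply: IHn; rewrite size_comp_poly2 ?size_XaddC //; move: sp;
  rewrite size_MXaddC (negPf q0).
Qed.

Definition charlier_sum p : C := limn (series (charlier_term p)).

Lemma charlier_sumP p l :
  series (charlier_term p) @ \oo --> l <-> charlier_sum p = l.
Proof.
split=> [pl|<-]; last exact: cvg_charlier.
exact/cvg_lim.
Qed.

Lemma charlier_sumD p q : charlier_sum (p + q) =
  charlier_sum p + charlier_sum q.
Proof.
apply/charlier_sumP; rewrite charlier_termD seriesD.
by apply: cvgD; apply/charlier_sumP.
Qed.

Lemma charlier_sumZ c p : charlier_sum (c *: p) = c * charlier_sum p.
Proof.
apply/charlier_sumP; rewrite charlier_termZ seriesZ.
by apply: cvgM; [exact: cvg_cst | apply/charlier_sumP].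
Qed.

Lemma charlier_sum_shift p :
  charlier_sum ('X * (p \Po ('X + (-1)%:P))) = a * charlier_sum p.
Proof. by apply/charlier_sumP/cvg_charlier_shift/charlier_sumP. Qed.

(** A positive term is a lower bound of all later partial sums, which then
    cannot tend to 0. *)
Lemma charlier_sum_eq0 p : 0 < a ->
  (forall x : nat, 0 <= p.[x%:R]) -> charlier_sum p = 0 ->
  forall x : nat, p.[x%:R] = 0.
Proof.
move=> a0 p0 /charlier_sumP /cvgrPdist_lt sp x.
have t0 y : 0 <= charlier_term p y.
  by rewrite mulr_ge0 ?p0 // divr_ge0 ?ler0n // exprn_ge0 // ltW.
have [-> //|px] := eqVneq p.[x%:R] 0.
have tx : 0 < charlier_term p x.
  rewrite lt_def t0 andbT mulf_neq0 // mulf_neq0 //.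
    by rewrite expf_neq0 // gt_eqF.
  by rewrite invr_eq0 pnatr_eq0 -lt0n fact_gt0.
(* An index beyond x.+1, for the partial sum to include the term of index x. *)
have [M _ /(_ (maxn M x.+1))] := sp _ tx.
rewrite /= leq_maxl sub0r normrN => /(_ isT).
rewrite ger0_norm ?sumr_ge0 // /series /= => /lt_geF/negP[].
rewrite (big_cat_nat (n := x.+1)) ?leq_maxr //= big_nat_recr //=.
by rewrite -addrA addrCA lerDl addr_ge0 ?sumr_ge0.
Qed.

End CharlierSum.

Lemma charlier_functional (C : numClosedFieldType) (a : C) :
  cvgn (series (charlier_term a 1)) ->
  exists L : {scalar {poly C}}, forall p, L p = charlier_sum a p.
Proof.
move=> cvg1.
have lin : linear_for *%R (charlier_sum a : {poly C} -> C).
  by move=> c p q; rewrite charlier_sumD // charlier_sumZ.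
pose m := GRing.isLinear.Build C {poly C} C *%R _ lin.
by exists (HB.pack_for {scalar {poly C}} (charlier_sum a : {poly C} -> C) m).
Qed.

(** * Symmetric operators and orthogonal families *)

Section Pairing.
Variables (C : numClosedFieldType) (N : nat) (a : C) (L : {scalar {poly C}}).
Hypothesis a_real : a^* = a.
Hypothesis L_shift : forall p, L ('X * (p \Po ('X + (-1)%:P))) = a * L p.
Variable W : 'M[{poly C}]_N.
Hypothesis W_star : pstar W = W.
Implicit Types (P Q : 'M[{poly C}]_N) (M : 'M[C]_N).
Local Notation CM M := (map_mx (@polyC C) M).

Definition LM P : 'M[C]_N := map_mx L P.
Definition pairing P Q : 'M[C]_N := LM (P *m W *m pstar Q).

Lemma LMD P Q : LM (P + Q) = LM P + LM Q.
Proof. by apply/matrixP => i j; rewrite !mxE linearD. Qed.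
Lemma LMN P : LM (- P) = - LM P.
Proof. by apply/matrixP => i j; rewrite !mxE linearN. Qed.
Lemma LMZ c P : LM (c%:P *: P) = c *: LM P.
Proof. by apply/matrixP => i j; rewrite !mxE mul_polyC linearZ. Qed.
Lemma LMCl M P : LM (CM M *m P) = M *m LM P.
Proof.
apply/matrixP => i j; rewrite !mxE linear_sum; apply: eq_bigr => k _.
by rewrite !mxE mul_polyC linearZ.
Qed.
Lemma LMCr M P : LM (P *m CM M) = LM P *m M.
Proof.
apply/matrixP => i j; rewrite !mxE linear_sum; apply: eq_bigr => k _.
by rewrite !mxE mulrC mul_polyC linearZ mulrC.
Qed.
Lemma LM_shift P : LM ('X *: pshift (-1) P) = a *: LM P.
Proof. by apply/matrixP => i j; rewrite !mxE L_shift. Qed.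

Lemma pairingDl P P' Q : pairing (P + P') Q = pairing P Q + pairing P' Q.
Proof. by rewrite /pairing !mulmxDl LMD. Qed.
Lemma pairingNl P Q : pairing (- P) Q = - pairing P Q.
Proof. by rewrite /pairing !mulNmx LMN. Qed.
Lemma pairingCl M P Q : pairing (CM M *m P) Q = M *m pairing P Q.
Proof. by rewrite /pairing -!mulmxA LMCl. Qed.
Lemma pairingDr P Q Q' : pairing P (Q + Q') = pairing P Q + pairing P Q'.
Proof. by rewrite /pairing pstarD mulmxDr LMD. Qed.
Lemma pairingCr M P Q : pairing P (CM M *m Q) = pairing P Q *m M^t*.
Proof. by rewrite /pairing pstarM pstarC mulmxA LMCr. Qed.

(** Summation by parts exchanges the terms in P(x+1) and P(x-1): [up] and [down]
    are the two directions. *)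
Lemma polyop_adjoint F1 F0 G P Q :
  F0 *m W = W *m pstar F0 ->
  F1 *m W = a%:P *: pshift 1 (W *m pstar G) ->
  pairing (polyop F1 F0 ('X *: G) P) Q = pairing P (polyop F1 F0 ('X *: G) Q).
Proof.
move=> F0W F1W.
have WF1 : W *m pstar F1 = a%:P *: pshift 1 (G *m W).
  have := congr1 (@pstar _ _) F1W.
  rewrite pstarM W_star pstarZ map_polyC /= a_real pstar_shift rmorph1.
  by rewrite pstarM pstarK W_star.
have up R S : pairing (pshift 1 R *m F1) S =
  pairing R (pshift (-1) S *m ('X *: G)).
  rewrite /pairing pstarM pstarX pstar_shift rmorphN rmorph1.
  rewrite -scalemxAl -!scalemxAr -[pshift 1 R *m _ *m _]mulmxA F1W.
  rewrite -scalemxAr -scalemxAl LMZ -LM_shift; congr (LM ('X *: _)).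
  by rewrite !pshiftM !pshiftK !mulmxA.
have down R S : pairing (pshift (-1) R *m ('X *: G)) S =
  pairing R (pshift 1 S *m F1).
  rewrite /pairing pstarM pstar_shift rmorph1 -scalemxAr -!scalemxAl.
  rewrite [X in _ = LM X]mulmxA -(mulmxA R) WF1 -scalemxAr -!scalemxAl.
  rewrite LMZ -LM_shift; congr (LM ('X *: _)).
  by rewrite !pshiftM !pshiftK !mulmxA.
have mid R S : pairing (R *m F0) S = pairing R (S *m F0).
  by rewrite /pairing pstarM !mulmxA -(mulmxA R F0) F0W mulmxA.
rewrite /polyop !pairingDl !pairingDr up down mid.
by rewrite addrC addrA addrAC.
Qed.

Variables (P : nat -> 'M[{poly C}]_N) (Gamma : nat -> 'M[C]_N).
Variable D : 'M[{poly C}]_N -> 'M[{poly C}]_N.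
Hypothesis P_monic : forall n, lead n (P n) 1%:M.
Hypothesis P_orth : forall m n, m <> n -> pairing (P m) (P n) = 0.
Hypothesis pairing_def : forall Q, pairing Q Q = 0 -> Q = 0.
Hypothesis D_lead : forall n Q M, lead n Q M -> lead n (D Q) (M *m Gamma n).
Hypothesis D_sym : forall Q R, pairing (D Q) R = pairing Q (D R).
Hypothesis DB : forall Q R, D (Q - R) = D Q - D R.

Lemma size_le0 Q : size_le 0 Q -> Q = 0.
Proof.
move=> s; apply/matrixP => i j; rewrite mxE; apply/eqP.
by rewrite -size_poly_leq0 s.
Qed.

(** Induction on d: subtracting a multiple of P_d removes the leading
    coefficient of Q. *)
Lemma pairing_low n d Q : (d <= n)%N -> size_le d Q -> pairing (P n) Q = 0.
Proof.
elim: d Q => [|d IHd] Q dn sQ.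
  by rewrite (size_le0 sQ) /pairing /pstar map_mx0 trmx0 mulmx0 /LM map_mx0.
have lQ := size_le_lead sQ; set M := map_mx _ _ in lQ.
rewrite -[Q](subrK (CM M *m P d)) pairingDr pairingCr P_orth ?mul0mx ?addr0.
  apply: IHd (ltnW dn) _; apply: lead0_size_le.
  by have := leadB lQ (leadCM M (P_monic d)); rewrite mulmx1 subrr.
by move=> nd; rewrite nd ltnn in dn.
Qed.

Lemma size_le_D n Q : size_le n Q -> size_le n (D Q).
Proof.
case: n => [s|n /size_le_lead/D_lead[]//].
by rewrite (size_le0 s) -(subrr 0) DB subrr => i j; rewrite mxE size_poly0.
Qed.

(** The difference E of both sides has degree below n, and so has D E. Hence P_n
    is orthogonal to both, and moving D across the pairing gives <E, E> = 0. *)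
Lemma symmetric_eigen n : D (P n) = CM (Gamma n) *m P n.
Proof.
apply/eqP; rewrite -subr_eq0; apply/eqP/pairing_def; set E := _ - _.
have sE : size_le n E.
  apply: lead0_size_le.
  have := leadB (D_lead (P_monic n)) (leadCM (Gamma n) (P_monic n)).
  by rewrite mulmx1 mul1mx subrr.
rewrite {1}/E pairingDl pairingNl pairingCl D_sym.
by rewrite !(@pairing_low _ n) ?mulmx0 ?subrr //; exact: size_le_D.
Qed.
End Pairing.

(** * Conjugation by powers of a unipotent matrix *)

Section Powers.
Variables (C : numFieldType) (n : nat) (U V J : 'M[C]_n).
Hypotheses (UV : U *m V = 1%:M) (J_U : J *m U = U *m J + U - 1%:M).

Lemma powU_unit m : U ^+ m \in unitmx.
Proof.
elim: m => [|m IHm]; first by rewrite expr0 unitmx1.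
by rewrite expmxS unitmx_mul IHm andbT; have [] := mulmx1_unit UV.
Qed.

Lemma V_powU m : V *m U ^+ m = U ^+ m *m V.
Proof.
have VU := mulmx1C UV.
elim: m => [|m IHm]; first by rewrite expr0 mul1mx mulmx1.
by rewrite {1}expmxS mulmxA VU mul1mx expmxSr -mulmxA UV mulmx1.
Qed.

(** The commutation relation of J with U, integrated to the powers of U. *)
Lemma J_powU m : J *m U ^+ m = U ^+ m *m J + m%:R *: (U ^+ m *m (1%:M - V)).
Proof.
have VU := mulmx1C UV.
elim: m => [|m IHm]; first by rewrite expr0 scale0r mulmx1 mul1mx addr0.
rewrite expmxSr mulmxA IHm !mxnorm -!(mulmxA (U ^+ m)) J_U VU UV !mxnorm -natr1.
mxring.
Qed.

Lemma powU_J m : U ^+ m *m J = (J - m%:R *: (1%:M - V)) *m U ^+ m.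
Proof. by rewrite !mxnorm J_powU V_powU !mxnorm; mxring. Qed.
End Powers.

(** * Symmetry of the coefficients *)

(** The matrices U, V, J and T stand for those of the Charlier family, which
    enter only through the relations assumed here; Up l and Phi l are matrix
    polynomials known by their values at natural x. *)
Section SymmetricCoefficients.
Variables (C : numClosedFieldType) (N : nat) (a : C) (U V J T : 'M[C]_N).
Local Notation CM M := (map_mx (@polyC C) M).
Local Notation Us := (U^t*).
Hypothesis a_real : a^* = a.
Hypotheses (UV : U *m V = 1%:M) (J_U : J *m U = U *m J + U - 1%:M).
Let VU : V *m U = 1%:M := mulmx1C UV.
Variables (lam : nat).
Hypotheses (J_T : J *m T = T *m J) (J_adj : J^t* = J) (T_adj : T^t* = T).
Hypothesis J_Us_T : J *m Us *m T =
  J *m T + (J + lam%:R *: 1%:M) *m T *m (Us - 1%:M).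
Hypothesis JAsAT_herm :
  (J *m (Us - 1%:M) *m (U - 1%:M) *m T)^t* =
    J *m (Us - 1%:M) *m (U - 1%:M) *m T.

Variables (Up Phi : nat -> 'M[{poly C}]_N).
Hypothesis Up_nat : forall l x, evalmx (Up l) x%:R = U ^+ (x + l).
Hypothesis Phi_nat : forall l x, evalmx (Phi l) x%:R *m U ^+ (x + l) =
  (a / 2) *: (U ^+ (x + l).+1 *m (J *m Us + l%:R *: 1%:M)).

(** The coefficient of eta^-1 in S^(l), divided by x (see [PhiPsiE]). It is the
    conjugate of (J + l) / 2 by U^(x + l), which [powU_J] makes explicit. *)
Definition Gpol (l : nat) : 'M[{poly C}]_N :=
  CM (2^-1 *: (J + l%:R *: V)) - 'X *: CM (2^-1 *: (1%:M - V)).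
(** The weight without its scalar factor a^x / x!. *)
Definition Wpol : 'M[{poly C}]_N := Up lam *m CM T *m pstar (Up lam).

Lemma Gpol_nat l x : evalmx (Gpol l) x%:R *m U ^+ (x + l) =
  2^-1 *: (U ^+ (x + l) *m (J + l%:R *: 1%:M)).
Proof.
rewrite evalmxD evalmxN evalmxZ !evalmxC hornerX mulmxDr (powU_J UV J_U).
by rewrite !mxnorm natrD; mxring.
Qed.

Lemma Wpol_star : pstar Wpol = Wpol.
Proof. by rewrite !pstarM pstarK pstarC T_adj mulmxA. Qed.

Lemma Wpol_nat x : evalmx Wpol x%:R =
  U ^+ (x + lam) *m T *m (U ^+ (x + lam))^t*.
Proof. by rewrite !evalmxM evalmxC evalmx_pstar ?realn // Up_nat. Qed.

Lemma V_powS m : V *m U ^+ m.+1 = U ^+ m.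
Proof. by rewrite expmxS mulmxA VU mul1mx. Qed.

(** Congruent to S by a power of U, hence Hermitian when S is; most products
    of a coefficient with the weight have this shape. *)
Definition sandwich m S : 'M[C]_N := U ^+ m *m S *m (U ^+ m)^t*.

Lemma sandwich_adj m S : S^t* = S -> (sandwich m S)^t* = sandwich m S.
Proof. by move=> SS; rewrite /sandwich !adjM trmxCK SS mulmxA. Qed.

Lemma JT_adj (l : C) : l^* = l ->
  ((J + l *: 1%:M) *m T)^t* = (J + l *: 1%:M) *m T.
Proof.
move=> ll; rewrite adjM adjD adjZ adj1 ll J_adj T_adj mulmxDl mulmxDr J_T.
by rewrite -scalemxAr -scalemxAl mul1mx mulmx1.
Qed.

(** The first condition of [polyop_adjoint], from its values. *)
Lemma self_adjoint_coef F0 :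
  (forall x : nat, (evalmx F0 x%:R *m evalmx Wpol x%:R)^t* =
     evalmx F0 x%:R *m evalmx Wpol x%:R) ->
  F0 *m Wpol = Wpol *m pstar F0.
Proof.
move=> H; apply: evalmx_nat_inj => x.
rewrite (evalmxM F0) (evalmxM Wpol) evalmx_pstar ?realn //
  -{1}H adjM -(evalmx_pstar Wpol) ?realn // Wpol_star.
by [].
Qed.

(** The second condition of [polyop_adjoint], from its values. *)
Lemma adjoint_coef F1 G :
  (forall x : nat, evalmx F1 x%:R *m evalmx Wpol x%:R =
     a *: (evalmx G x.+1%:R *m evalmx Wpol x.+1%:R)^t*) ->
  F1 *m Wpol = a%:P *: pshift 1 (Wpol *m pstar G).
Proof.
move=> H; apply: evalmx_nat_inj => x.
rewrite evalmxM H evalmxZ hornerC evalmx_shift natr1 -evalmxM.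
rewrite -evalmx_pstar ?realn // pstarM Wpol_star.
by [].
Qed.

Lemma Dop_coef1_adjoint : CM (a *: U) *m Wpol =
  a%:P *: pshift 1 (Wpol *m pstar (CM V)).
Proof.
apply: adjoint_coef => x; rewrite !evalmxC !Wpol_nat addSn.
rewrite !(mulmxA V) V_powS !adjM trmxCK T_adj -scalemxAl !mulmxA.
by rewrite -expmxS.
Qed.

Lemma Dop_coef0_symmetric (F0 := - CM J - ('X + lam%:R%:P) *: CM V) :
  F0 *m Wpol = Wpol *m pstar F0.
Proof.
apply: self_adjoint_coef => x.
suff -> : evalmx F0 x%:R *m evalmx Wpol x%:R =
    - sandwich (x + lam) ((J + (x + lam)%:R *: 1%:M) *m T).
  by rewrite linearN map_mxN /= sandwich_adj // JT_adj // rmorph_nat.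
rewrite evalmxD !evalmxN evalmxZ !evalmxC !hornerE Wpol_nat /sandwich -natrD.
rewrite !mulmxA mulmxDl !mulNmx -scalemxAl !(mulmxDl, mulmxA) (V_powU UV).
by rewrite (J_powU UV J_U) !mxnorm; mxring.
Qed.

Let HT : 'M[C]_N := (J + lam%:R *: 1%:M) *m T.
Let HT_adj : HT^t* = HT. Proof. by rewrite JT_adj // rmorph_nat. Qed.

Lemma sandwich_shift m S : U ^+ m.+1 *m S *m Us *m (U ^+ m)^t* =
  sandwich m.+1 S.
Proof. by rewrite /sandwich [in RHS]expmxSr adjM !mulmxA -expmxSr. Qed.

Lemma JUs_T : (J *m Us + lam%:R *: 1%:M) *m T = HT *m Us.
Proof. by rewrite /HT mulmxDl J_Us_T !mxnorm; mxring. Qed.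

(** Since a/2 (J + lam) T is the matrix T of parameter lam + 1, this is the
    weight of parameter lam + 1, up to the scalar factor. *)
Lemma Phi_W x : evalmx (Phi lam) x%:R *m evalmx Wpol x%:R =
  (a / 2) *: sandwich (x + lam).+1 HT.
Proof.
rewrite Wpol_nat !mulmxA Phi_nat -!scalemxAl; congr (_ *: _).
by rewrite -sandwich_shift -!(mulmxA (U ^+ _)) mulmxA JUs_T !mulmxA.
Qed.

Lemma Gpol_W x : evalmx (Gpol lam) x%:R *m evalmx Wpol x%:R =
  2^-1 *: sandwich (x + lam) HT.
Proof.
by rewrite Wpol_nat !mulmxA Gpol_nat /sandwich /HT -!scalemxAl !mulmxA.
Qed.

Lemma half_real : (2^-1 : C)^* = 2^-1.
Proof. by rewrite fmorphV rmorph_nat. Qed.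

Lemma a_half_real : (a / 2)^* = a / 2.
Proof. by rewrite rmorphM /= a_real half_real. Qed.

Lemma DeltaS_coef1_adjoint : - Phi lam *m Wpol =
  a%:P *: pshift 1 (Wpol *m pstar (- Gpol lam)).
Proof.
apply: adjoint_coef => x; rewrite !evalmxN !mulNmx Phi_W Gpol_W linearN
  map_mxN /=.
by rewrite adjZ half_real sandwich_adj // scalerN scalerA.
Qed.

Lemma DeltaS_coef0_symmetric (F0 := Phi lam + 'X *: Gpol lam) :
  F0 *m Wpol = Wpol *m pstar F0.
Proof.
apply: self_adjoint_coef => x.
rewrite evalmxD evalmxZ hornerX mulmxDl Phi_W -scalemxAl Gpol_W adjD !adjZ.
by rewrite !sandwich_adj // a_half_real half_real rmorph_nat.
Qed.

Variable l : nat.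
Hypothesis lamE : lam = l.+1.

Let HTpred : 'M[C]_N := (J + l%:R *: 1%:M) *m T.
Let HTpred_adj : HTpred^t* = HTpred.
Proof. by rewrite JT_adj // rmorph_nat. Qed.

Lemma Us_J : Us *m J = J *m Us + Us - 1%:M.
Proof.
have := congr1 (fun M => M^t*) J_U.
by rewrite !(linearB, linearD) /= !(map_mxB, map_mxD) !adjM adj1 J_adj.
Qed.

Lemma JUs_T_pred : (J *m Us + l%:R *: 1%:M) *m T =
  T *m Us *m (J + l%:R *: 1%:M).
Proof.
rewrite !mulmxDl J_Us_T !mulmxDr -(mulmxA T) Us_J lamE !mxnorm -!J_T -natr1.
mxring.
Qed.

(** Writing U and Us as identity plus nilpotent part, the matrix becomes the
    sum of a Hermitian product, of a matrix and its adjoint, and of a diagonal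
    matrix. *)
Lemma JUs_UT_adj (X := (J *m Us + l%:R *: 1%:M) *m U *m T) : X^t* = X.
Proof.
have K'T := congr1 (fun M => M^t*) JUs_T_pred.
have -> : X = J *m (Us - 1%:M) *m (U - 1%:M) *m T + (J *m
  Us + l%:R *: 1%:M) *m T
   + ((J *m Us + l%:R *: 1%:M) *m T)^t* - HTpred.
  rewrite {2}JUs_T_pred !adjM adjD adjZ rmorph_nat adj1 J_adj trmxCK T_adj /X
    /HTpred.
  by rewrite !mxnorm; mxring.
rewrite linearB map_mxB /= !adjD JAsAT_herm trmxCK HTpred_adj.
by rewrite -addrA [X in _ + X]addrC !addrA; mxring.
Qed.

Lemma SDelta_coef1_adjoint :
  - pshift 1 (Phi l) *m Wpol = a%:P *: pshift 1 (Wpol *m pstar (- Gpol l)).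
Proof.
apply: adjoint_coef => x; rewrite !evalmxN evalmx_shift natr1 !mulNmx.
have PhiX := Phi_nat l x.+1; have GX := Gpol_nat l x.+1.
rewrite linearN map_mxN /= !Wpol_nat addSn.
have e : (x.+1 + l = x + lam)%N by rewrite lamE addnS.
rewrite {}e in PhiX GX; set m := (x + lam)%N in PhiX GX *.
rewrite !mulmxA PhiX [in RHS]expmxSr !mulmxA GX.
rewrite -!scalemxAl adjZ half_real scalerN scalerA; congr (- (_ *: _)).
rewrite -!(mulmxA (U ^+ _)) JUs_T_pred !adjM T_adj adjD adjZ rmorph_nat adj1
  J_adj !trmxCK.
by rewrite expmxSr !mulmxA.
Qed.

Lemma SDelta_coef0_symmetric (F0 := Phi l + pshift 1 ('X *: Gpol l)) :
  F0 *m Wpol = Wpol *m pstar F0.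
Proof.
have e x : (x + lam = (x + l).+1)%N by rewrite lamE addnS.
apply: self_adjoint_coef => x.
rewrite evalmxD evalmx_shift natr1 evalmxZ hornerX mulmxDl -scalemxAl.
have -> : evalmx (Phi l) x%:R *m evalmx Wpol x%:R =
   (a / 2) *: sandwich (x + lam) ((J *m Us + l%:R *: 1%:M) *m U *m T).
  rewrite Wpol_nat /sandwich e {1}expmxSr !mulmxA Phi_nat -!scalemxAl.
  by [].
have -> : evalmx (Gpol l) x.+1%:R *m evalmx Wpol x%:R =
    2^-1 *: sandwich (x + lam) HTpred.
  by rewrite Wpol_nat !mulmxA e -addSn Gpol_nat /sandwich /HTpred -!scalemxAl
    !mulmxA.
rewrite adjD !adjZ !sandwich_adj ?JUs_UT_adj //.
by rewrite a_half_real half_real rmorph_nat.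
Qed.
End SymmetricCoefficients.

(** * Degree preservation and the eigenvalue matrices *)

Section Degree.
Variables (C : numClosedFieldType) (N : nat) (a nu : C) (U V J : 'M[C]_N).
Local Notation CM M := (map_mx (@polyC C) M).
Local Notation Us := (U^t*).
Hypotheses (a0 : a != 0).
Hypotheses (UV : U *m V = 1%:M) (J_U : J *m U = U *m J + U - 1%:M).
Hypothesis JUs_U : J *m Us *m U =
  U *m (J *m Us) + (U - 1%:M) + a^-1 *: (nu *: 1%:M - 2 *: J).
Local Notation G l := (Gpol V J l).

(** The coefficient of x in the matrix polynomial Phi(x) - x G(x), which is the
    adjoint of Psi. *)
Definition Psi1 l : 'M[C]_N := (a / 2) *: (1%:M - U) + 2^-1 *: J
  - ((nu + 1) / 2 + l%:R) *: 1%:M + (l.+1%:R / 2) *: V.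

(** By the hypothesis Phi(x + 1) is the conjugate of Phi(x) by U, so the first
    difference of Phi is given by the commutators of J and J Us with U. It
    differs from that of x G(x) by a constant: the quadratic parts of Phi and
    x G agree, which is why the operators built from them preserve degrees. *)
Lemma Phi_decomp (Phi : 'M[{poly C}]_N) l :
  (forall x, evalmx Phi x%:R *m U ^+ (x + l) =
    (a / 2) *: (U ^+ (x + l).+1 *m (J *m Us + l%:R *: 1%:M))) ->
  Phi = 'X *: G l + CM (evalmx Phi 0) + 'X *: CM (Psi1 l).
Proof.
move=> Phi_nat; apply: evalmx_nat_inj => x.
rewrite /Gpol !(evalmxD, evalmxN, evalmxZ, evalmxC, hornerX).
elim: x => [|x IHx]; first by rewrite !scale0r add0r addr0.
suff E : evalmx Phi x.+1%:R - evalmx Phi x%:R =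
    (a / 2) *: (1%:M - U) - (nu / 2) *: 1%:M + J - (x + l).+1%:R *: (1%:M - V).
  rewrite -[LHS](subrK (evalmx Phi x%:R)) E IHx /Psi1.
  rewrite -!natr1 !natrD; mxfield.
have PhiS := Phi_nat x.+1.
rewrite addSn [U ^+ (x + l).+2]expmxSr in PhiS.
have Phi0 := congr1 (mulmx^~ U) (Phi_nat x).
rewrite -mulmxA -expmxSr -scalemxAl in Phi0.
have Um := powU_unit UV (x + l).+1; have mE := powU_J UV J_U (x + l).+1.
set m := (x + l).+1 in PhiS Phi0 Um mE *; set Y := U ^+ m in PhiS Phi0 Um mE *.
apply: (unitmx_rcancel Um); rewrite mulmxBl PhiS Phi0 -addrA mulmxDl -mE.
have -> : ((a / 2) *: (1%:M - U) - (nu / 2) *: 1%:M) *m Y =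
    Y *m ((a / 2) *: (1%:M - U) - (nu / 2) *: 1%:M).
  have YU : Y *m U = U *m Y by rewrite -expmxSr -expmxS.
  by rewrite !mxnorm YU.
rewrite -!(mulmxA Y) [_ *m U]mulmxDl JUs_U.
by rewrite -!scalemx_mulr -mulmxDr -mulmxBr; congr (_ *m _); rewrite !mxnorm;
  mxfield.
Qed.

Variable lam : nat.
Definition GammaD (n : nat) : 'M[C]_N := a *: U - J - (n + lam)%:R *: V.
Definition Gamma_shift (n : nat) : C := nu + n%:R + 2 * lam%:R - a.
Definition GammaDS (n : nat) : 'M[C]_N :=
  (n%:R / 2) *: (GammaD n + Gamma_shift n *: 1%:M).
Definition GammaSD (n : nat) : 'M[C]_N :=
  (n.+1%:R / 2) *: (GammaD n + (Gamma_shift n - 1) *: 1%:M).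

Lemma Dop_lead n Q M : lead n Q M ->
  lead n (polyop (CM (a *: U)) (- CM J - ('X + lam%:R%:P) *: CM V)
            ('X *: CM V) Q)
    (M *m GammaD n).
Proof.
move=> QM.
have -> : polyop (CM (a *: U)) (- CM J - ('X + lam%:R%:P) *: CM V)
    ('X *: CM V) Q =
   pshift 1 Q *m CM (a *: U) - Q *m CM (J + lam%:R *: V)
   + ('X *: (pshift (-1) Q - Q)) *m CM V.
  rewrite /polyop map_mxD !map_mxZ /= !mxnorm; mxring.
have := leadD (leadB (leadMC (a *: U) (lead_shift 1 QM))
   (leadMC (J + lam%:R *: V) QM)) (leadMC V (leadX_diff (-1) QM)).
apply: lead_eq; rewrite /GammaD natrD !mxnorm; mxring.
Qed.

Variables (Phi : 'M[{poly C}]_N) (Psi0 : 'M[C]_N).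

(** Replacing Phi by x G plus a linear part, x G multiplies only a second
    difference of Q, which compensates its degree two. *)
Lemma DeltaS_lead n (Q : 'M[{poly C}]_N) M :
  Phi = 'X *: G lam + CM Psi0 + 'X *: CM (Psi1 lam) -> lead n Q M ->
  lead n (polyop (- Phi) (Phi + 'X *: G lam) ('X *: - G lam) Q)
    (M *m GammaDS n).
Proof.
move=> PhiE QM.
set Y := 'X *: (pshift 1 Q - Q - (Q - pshift (-1) Q)).
have -> : polyop (- Phi) (Phi + 'X *: G lam) ('X *: - G lam) Q =
   - ((pshift 1 Q - Q) *m CM Psi0) - ('X *: (pshift 1 Q - Q)) *m CM (Psi1 lam)
   - Y *m CM (2^-1 *: (J + lam%:R *: V)) + ('X *: Y) *m CM (2^-1 *: (1%:M - V)).
  rewrite /polyop PhiE /Y /Gpol.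
  move: (CM Psi0) (CM (Psi1 _)) (CM (_ *: (J + _))) (CM (_ *: (_ - _))) => c0
    c1 c2 c3.
  rewrite !mxnorm; mxring.
have YM : lead n Y 0.
  have := leadD (leadX_diff 1 QM) (leadX_diff (-1) QM).
  rewrite -scalerDr -scalerDl -mulrDl subrr mul0r scale0r.
  by congr (lead n ('X *: _) 0); mxring.
have := leadD (leadB (leadB (leadN (leadMC Psi0 (lead_diff 1 QM)))
   (leadMC (Psi1 lam) (leadX_diff 1 QM)))
   (leadMC (2^-1 *: (J + lam%:R *: V)) YM))
   (leadMC (2^-1 *: (1%:M - V)) (lead_diff2 QM)).
apply: lead_eq; rewrite /GammaDS /GammaD /Gamma_shift /Psi1 !mul0mx natrD
  -[lam.+1%:R]natr1 !mxnorm; mxfield.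
Qed.

(** By the same cancellation S raises degrees by at most one, and Delta lowers
    them again. *)
Lemma SDelta_lead l n (Q : 'M[{poly C}]_N) M : lam = l.+1 ->
  Phi = 'X *: G l + CM Psi0 + 'X *: CM (Psi1 l) -> lead n Q M ->
  lead n (polyop (- pshift 1 Phi) (Phi + pshift 1 ('X *: G l)) ('X *: - G l) Q)
    (M *m GammaSD n).
Proof.
move=> lamE PhiE QM.
set Y := 'X *: (pshift (-1) Q - Q).
pose S := Y *m CM (2^-1 *: (J + l%:R *: V))
  - 'X *: (Y *m CM (2^-1 *: (1%:M - V)))
  - Q *m CM Psi0 - 'X *: (Q *m CM (Psi1 l)).
have -> : polyop (- pshift 1 Phi) (Phi + pshift 1 ('X *: G l)) ('X *: - G l) Q =
   pshift 1 S - S.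
  have -> : S = pshift (-1) Q *m ('X *: G l) - Q *m Phi.
    rewrite /S PhiE /Y /Gpol.
    move: (CM Psi0) (CM (Psi1 _)) (CM (_ *: (J + _))) (CM (_ *: (_ - _))) =>
      c0 c1 c2 c3.
    rewrite !mxnorm; mxring.
  rewrite pshiftD pshiftN !pshiftM pshiftNK /polyop.
  move: (pshift 1 ('X *: _)) => c0.
  rewrite !mxnorm; mxring.
have YM := leadX_diff (-1) QM.
have SM := leadB (leadB (leadB (leadS (leadMC (2^-1 *: (J + l%:R *: V)) YM))
   (leadX (leadMC (2^-1 *: (1%:M - V)) YM))) (leadS (leadMC Psi0 QM)))
   (leadX (leadMC (Psi1 l) QM)).
apply: lead_eq (lead_diffS 1 SM).
rewrite /GammaSD /GammaD /Gamma_shift /Psi1 lamE natrD -[l.+1%:R]natr1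
  -[n.+1%:R]natr1 !mxnorm.
mxfield.
Qed.
End Degree.

(** * Condition (V) *)

Section BlockVandermonde.
Variables (C : numFieldType) (N : nat).
Implicit Types (E : 'M[C]_N).

Lemma mxdiag_unit n (D : 'I_n -> 'M[C]_N) :
  (forall i, D i \in unitmx) -> \mxdiag_(i < n) D i \in unitmx.
Proof.
move=> Du; suff /mulmx1_unit[] : \mxdiag_(i < n) D i *m
  \mxdiag_(i < n) invmx (D i) = 1%:M by [].
rewrite -mxdiagZ [X in _ *m X]/mxdiag mul_mxdiag_mxblock.
apply/eq_mxblock => i j; case: eqVneq => [->|_]; last by rewrite mulmx0.
by rewrite !conform_mx_id mulmxV.
Qed.

Lemma mxblock_scalar_unit n (M : 'M[C]_n) : M \in unitmx ->
  \mxblock_(i < n, j < n) (M i j *: (1%:M : 'M[C]_N)) \in unitmx.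
Proof.
move=> Mu; suff /mulmx1_unit[] :
  \mxblock_(i < n, j < n) (M i j *: (1%:M : 'M[C]_N)) *m
  \mxblock_(i < n, j < n) (invmx M i j *: (1%:M : 'M[C]_N)) = 1%:M by [].
rewrite mul_mxblock -mxdiagZ; apply/eq_mxblock => i k.
under eq_bigr do rewrite -scalemxAl mul1mx scalerA.
rewrite -scaler_suml; have /matrixP/(_ i k) := mulmxV Mu; rewrite !mxE => ->.
by case: eqVneq => [_|_]; rewrite ?scale0r // scale1r conform_mx_id.
Qed.

Lemma Vandermonde_unit n : \matrix_(i < n, j < n) (i.+1%:R ^+ j : C) \in unitmx.
Proof.
rewrite -unitmx_tr (_ : _^T = Vandermonde n (\row_i i.+1%:R)); last first.
  by apply/matrixP => i j; rewrite !mxE.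
rewrite unitmxE det_Vandermonde unitfE; apply/prodf_neq0 => i _.
apply/prodf_neq0 => j ij; rewrite !mxE subr_eq0 eqr_nat eqSS.
by rewrite gtn_eqF.
Qed.

Lemma unitmxX n E : E \in unitmx -> E ^+ n \in unitmx.
Proof.
move=> Eu; elim: n => [|n IHn]; first by rewrite expr0 unitmx1.
by rewrite expmxS unitmx_mul Eu.
Qed.

(** The matrix is the Vandermonde matrix of 1, ..., n tensored with the
    identity, times a block diagonal matrix of powers of E. *)
Lemma block_vandermonde_scaled n E : E \in unitmx ->
  \mxblock_(i < n, j < n) (i.+1%:R *: E) ^+ j \in unitmx.
Proof.
move=> Eu.
have -> : \mxblock_(i < n, j < n) (i.+1%:R *: E) ^+ j =
  \mxblock_(i < n, j < n)
     ((\matrix_(i < n, j < n) (i.+1%:R ^+ j : C)) i j *: (1%:M : 'M[C]_N)) *m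
  \mxdiag_(j < n) (E ^+ j).
  rewrite mul_mxblock_mxdiag; apply/eq_mxblock => i j.
  by rewrite mxE -scalemxAl mul1mx expmxZ.
rewrite unitmx_mul mxblock_scalar_unit ?Vandermonde_unit // mxdiag_unit // => j.
exact: unitmxX.
Qed.

Lemma nonzero_inv_nat (p : {poly C}) : p != 0 ->
  exists t : nat, p.[t.+1%:R^-1] != 0.
Proof.
move=> p0; have [//|H] := pselect (exists t : nat, p.[t.+1%:R^-1] != 0).
move/eqP: p0; case.
apply: (@roots_geq_poly_eq0 _ _ [seq i.+1%:R^-1 | i <- iota 0 (size p)]).
- apply/allP => _ /mapP[i _ ->]; rewrite rootE; apply/negPn/negP => pi.
  by case: H; exists i.
- rewrite map_inj_uniq ?iota_uniq // => i j /invr_inj/eqP.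
  by rewrite eqr_nat eqSS => /eqP.
- by rewrite size_map size_iota.
Qed.

(** Take k_i = (i + 1) t and s = 1 / t. Multiplying the i-th block row by
    q(1 / k_i)^x and the j-th block column by s^j turns the block Vandermonde
    matrix into the matrix B, polynomial in s, whose value at s = 0 is the one
    of [block_vandermonde_scaled] for E = R(0). So the determinant of B is a
    nonzero polynomial and some 1 / t is not among its roots. *)
Lemma condV_exists (rho : nat -> 'M[C]_N) (R : 'M[{poly C}]_N) (q : {poly C}) :
  q.[0] = 1 -> evalmx R 0 \in unitmx ->
  (forall n : nat, q.[n.+1%:R^-1] *: rho n.+1 =
    n.+1%:R *: evalmx R n.+1%:R^-1) ->
  forall x : nat, exists k : 'I_x.+1 -> nat,
    \mxblock_(i < x.+1, j < x.+1) (rho (k i) ^+ j) \in unitmx.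
Proof.
move=> q0 R0 rhoE x; set n := x.+1.
pose s_ (i : nat) : {poly C} := i.+1%:R^-1 *: 'X.
pose R_ i := map_mx (comp_poly (s_ i)) R.
have R_E i s : evalmx (R_ i) s = evalmx R (i.+1%:R^-1 * s).
  by apply/matrixP => u v; rewrite !mxE horner_comp !hornerE.
pose B := \mxblock_(i < n, j < n)
  ((q \Po s_ i) ^+ (x - j) *: (i.+1%:R%:P *: R_ i) ^+ j).
have BE s : map_mx (horner^~ s) B = \mxblock_(i < n, j < n)
  (q.[i.+1%:R^-1 * s] ^+ (x - j)
   *: (i.+1%:R *: evalmx R (i.+1%:R^-1 * s)) ^+ j).
  have e i j : evalmx ((q \Po s_ i) ^+ (x - j) *: (i.+1%:R%:P *: R_ i) ^+ j) s =
    q.[i.+1%:R^-1 * s] ^+ (x - j)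
    *: (i.+1%:R *: evalmx R (i.+1%:R^-1 * s)) ^+ j.
    by rewrite evalmxZ evalmxX evalmxZ R_E hornerC horner_exp horner_comp
      !hornerE.
  apply/matrixP => u v; rewrite mxE [B u v]mxE [RHS]mxE -e [RHS]mxE.
  by [].
have detB s : (\det B).[s] = \det (map_mx (horner^~ s) B).
  exact: (esym (det_map_mx (horner_eval s) B)).
have [|t dt] := @nonzero_inv_nat (\det B).
  apply: contraTneq (block_vandermonde_scaled n R0) => B0.
  have := detB 0; rewrite B0 horner0 BE => d0.
  rewrite unitmxE unitfE negbK; apply/eqP; rewrite [RHS]d0; congr (\det _).
  by apply/eq_mxblock => i j; rewrite mulr0 q0 expr1n scale1r.
exists (fun i => i.+1 * t.+1)%N.
set Vr := \mxblock_(_, _) _.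
suff E : map_mx (horner^~ t.+1%:R^-1) B =
   \mxdiag_(i < n) ((q.[i.+1%:R^-1 * t.+1%:R^-1] ^+ x)%:M) *m Vr *m
   \mxdiag_(j < n) ((t.+1%:R^-1 ^+ j)%:M).
  move: dt; rewrite detB E -unitfE -unitmxE !unitmx_mul => /andP[/andP[_ ->]]
    //.
rewrite BE mul_mxdiag_mxblock mul_mxblock_mxdiag; apply/eq_mxblock => i j.
rewrite mul_scalar_mx mul_mx_scalar.
have := rhoE (i.+1 * t.+1).-1; rewrite prednK ?muln_gt0 // natrM invfM.
set y := i.+1%:R^-1 * _; move=> rE.
have -> : i.+1%:R *: evalmx R y = t.+1%:R^-1 *: (q.[y] *: rho (i.+1 * t.+1)%N).
  by rewrite rE scalerA mulrCA mulVf ?mulr1 // pnatr_eq0.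
rewrite !scalerA expmxZ !scalerA exprMn; congr (_ *: _).
have jx : (j <= x)%N by rewrite -ltnS ltn_ord.
by rewrite -[in RHS](subnK jx) exprD; ring.
Qed.
End BlockVandermonde.

Section AffineFamily.
Variables (C : numFieldType) (N : nat) (S Z L : 'M[C]_N).
Variables (al1 be1 al2 be2 : C).
Local Notation CM M := (map_mx (@polyC C) M).
Hypotheses (S_unit : S \in unitmx).
Hypothesis Z_unit : forall n : nat, Z + n%:R *: 1%:M \in unitmx.
Hypothesis E_unit : al1 *: Z + al2 *: 1%:M \in unitmx.

(** Up to a scalar and conjugation, the action of the eigenvalue matrix of
    index n on P_n(0), see [GammaD_theta]. *)
Definition theta (n : nat) : 'M[C]_N :=
  (L + n%:R *: 1%:M) *m Z *m invmx (Z + n%:R *: 1%:M).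
Definition affine_rho (n : nat) : 'M[C]_N :=
  S *m ((al1 * n%:R + be1) *: theta n + (al2 * n%:R + be2) *: 1%:M) *m invmx S.

Lemma affine_rho_rational : exists r : 'M[ratfun C]_N,
  forall n : nat, ratmx_value r n%:R (affine_rho n).
Proof.
(* The common denominator is det (Z + n), and Z + n is invertible. *)
pose ZX := CM Z + 'X *: 1%:M; pose d := \det ZX.
have ZXE n : evalmx ZX n%:R = Z + n%:R *: 1%:M.
  by rewrite evalmxD evalmxC evalmxZ evalmx1 hornerX.
pose R := CM S *m ((al1 *: 'X + be1%:P) *: ((CM L + 'X *: 1%:M) *m CM Z *m
  \adj ZX)
  + ((al2 *: 'X + be2%:P) * d) *: 1%:M) *m CM (invmx S).
exists (\matrix_(i, j) (FracField.tofrac (R i j) / FracField.tofrac d)) => n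
  i j.
have dn : d.[n%:R] != 0.
  by rewrite det_evalmx ZXE -unitfE -unitmxE.
exists (R i j), d; split=> //; first by rewrite mxE.
suff -> : affine_rho n = d.[n%:R]^-1 *: evalmx R n%:R by rewrite !mxE mulrC.
rewrite /R !evalmxM !evalmxC evalmxD !evalmxZ !evalmxM evalmxD evalmxZ evalmx1.
rewrite !evalmxC adj_evalmx ZXE !hornerE.
have ZV : invmx (Z + n%:R *: 1%:M) = d.[n%:R]^-1 *: \adj (Z + n%:R *: 1%:M).
  by rewrite /invmx Z_unit det_evalmx ZXE.
rewrite /affine_rho /theta ZV [in RHS]scalemxAl [in RHS]scalemxAr.
congr (_ *m _ *m _); rewrite -scalemxAr scalerDr !scalerA.
by congr (_ *: _ + _ *: _); field.
Qed.

(** For s = 1 / n, theta n = (1 + s L) Z (1 + s Z)^-1, so that rho(n) / n is a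
    rational function of s with denominator det (1 + s Z) and value
    S (al1 Z + al2) S^-1 at s = 0. *)
Lemma affine_rho_condV : condV affine_rho.
Proof.
split; first exact: affine_rho_rational.
pose ZR : 'M[{poly C}]_N := 1%:M + 'X *: CM Z; pose q := \det ZR.
have ZRE s : evalmx ZR s = 1%:M + s *: Z.
  by rewrite evalmxD evalmx1 evalmxZ evalmxC hornerX.
pose R := CM S *m ((al1%:P + be1 *: 'X) *: ((1%:M + 'X *: CM L) *m CM Z *m
  \adj ZR)
  + ((al2%:P + be2 *: 'X) * q) *: 1%:M) *m CM (invmx S).
have q0 : q.[0] = 1 by rewrite det_evalmx ZRE scale0r addr0 det1.
have RE s : evalmx R s = S *m ((al1 + be1 * s) *: ((1%:M + s *: L) *m Z *m
  \adj (1%:M + s *: Z))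
  + ((al2 + be2 * s) * q.[s]) *: 1%:M) *m invmx S.
  rewrite /R !evalmxM !evalmxC evalmxD !evalmxZ !evalmxM evalmxD evalmxZ
    !evalmx1.
  by rewrite !evalmxC adj_evalmx ZRE !hornerE.
apply: (condV_exists q0 (R := R)).
  rewrite RE !mulr0 !addr0 q0 mulr1 !scale0r !addr0 mul1mx.
  rewrite (_ : \adj 1%:M = 1%:M) ?mulmx1; last first.
    by have := mul_mx_adj (1%:M : 'M[C]_N); rewrite mul1mx det1.
  by rewrite !unitmx_mul S_unit E_unit unitmx_inv.
move=> n; have [s s0 nE] : exists2 s : C, s != 0 & n.+1%:R = s^-1.
  by exists n.+1%:R^-1; rewrite ?invrK // invr_eq0 pnatr_eq0.
have := Z_unit n.+1; rewrite nE invrK => Zu.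
have ZE : Z + s^-1 *: 1%:M = s^-1 *: (1%:M + s *: Z).
  by rewrite scalerDr scalerA mulVf // scale1r addrC.
have Z1u : 1%:M + s *: Z \in unitmx.
  by move: Zu; rewrite ZE unitmxZ // unitfE invr_eq0.
have qs : q.[s] != 0 by rewrite det_evalmx ZRE -unitfE -unitmxE.
have ZV : invmx (1%:M + s *: Z) = q.[s]^-1 *: \adj (1%:M + s *: Z).
  by rewrite /invmx Z1u det_evalmx ZRE.
have LE : L + s^-1 *: 1%:M = s^-1 *: (1%:M + s *: L).
  by rewrite scalerDr scalerA mulVf // scale1r addrC.
rewrite RE /affine_rho /theta nE ZE invmxZ -?ZE // invrK ZV LE.
rewrite -!(mulmxA S) !(scalemxAr _ S) !(scalemxAl _ _ (invmx S)).
congr (_ *m (_ *m _)); rewrite -!scalemxAr -!scalemxAl !scalerDr !scalerA.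
by congr (_ *: _ + _ *: _); field; rewrite ?s0 ?qs.
Qed.
End AffineFamily.

(** * Values at zero *)

Section ValuesAtZero.
Variables (C : numClosedFieldType) (N : nat).
Local Notation CM M := (map_mx (@polyC C) M).

Lemma evalmx0X (G : 'M[{poly C}]_N) : evalmx ('X *: G) 0 = 0.
Proof. by rewrite evalmxZ hornerX scale0r. Qed.

Lemma ratmx_value_polymx (F : 'M[{poly C}]_N) x : ratmx_value (polymx F) x
  (evalmx F x).
Proof.
move=> i j; exists (F i j), 1; rewrite hornerC oner_neq0 tofrac1 !divr1.
by rewrite !mxE.
Qed.

Lemma BR2_polyop (P : nat -> 'M[{poly C}]_N) (D : difop C N) F1 F0 G
    (Gamma : nat -> 'M[C]_N) :
  (forall Q, D Q = difop_of F1 F0 ('X *: G) Q) ->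
  (forall n, polyop F1 F0 ('X *: G) (P n) = CM (Gamma n) *m P n) ->
  (forall n, evalmx (P n) 0 \in unitmx) ->
  (forall x : nat, evalmx F1 x%:R \in unitmx) ->
  condV (fun n => invmx (evalmx (P n) 0) *m Gamma n *m evalmx (P n) 0) ->
  BR2 P D.
Proof.
move=> DE eig P0 F1u cV.
exists (polymx F1), (polymx F0), (polymx ('X *: G)); split=> //.
exists Gamma; split=> //.
- by move=> n; rewrite DE difop_ofE eig polymxM.
- exists 0, 0; split; last by move=> n; rewrite mulmx0.
  by rewrite -(evalmx0X G); exact: ratmx_value_polymx.
- by move=> x; exists (evalmx F1 x%:R); split=> //; exact: ratmx_value_polymx.
Qed.

Lemma evalmx_polyop (F1 F0 G P : 'M[{poly C}]_N) x :
  evalmx (polyop F1 F0 G P) x =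
  evalmx P (x + 1) *m evalmx F1 x + evalmx P x *m evalmx F0 x
  + evalmx P (x - 1) *m evalmx G x.
Proof. by rewrite !evalmxD !evalmxM !evalmx_shift. Qed.

(** As F1 is invertible, the eigenvalue equation is a recurrence for the values
    of P; its term in P(-1) is absent at x = 0, and Gamma P(0) = P(0) X moves
    Gamma to the right of P(0). So P(x) = P(0) Y_x for all natural x, and a
    vector of the left kernel of P(0) annihilates P, hence its leading
    coefficient 1. *)
Lemma eval0_unit n (P F1 F0 G : 'M[{poly C}]_N) Gamma X :
  lead n P 1%:M ->
  polyop F1 F0 ('X *: G) P = CM Gamma *m P ->
  (forall x : nat, evalmx F1 x%:R \in unitmx) ->
  Gamma *m evalmx P 0 = evalmx P 0 *m X -> evalmx P 0 \in unitmx.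
Proof.
move=> P1 eig F1u GX.
have rec (x : nat) Y Y' : evalmx P x%:R = evalmx P 0 *m Y ->
    x%:R *: evalmx P (x%:R - 1) = evalmx P 0 *m Y' ->
    evalmx P x.+1%:R = evalmx P 0 *m ((X *m Y - Y *m evalmx F0 x%:R
      - Y' *m evalmx G x%:R) *m invmx (evalmx F1 x%:R)).
  move=> PY PY'; have := congr1 (fun M => evalmx M x%:R) eig.
  rewrite evalmx_polyop evalmxM evalmxC evalmxZ hornerX PY natr1 -scalemxAr
    scalemxAl PY'.
  move=> /(canRL (addrK _))/(canRL (addrK _)) E.
  rewrite mulmxA; apply: (canRL (mulmxK (F1u x))); rewrite E.
  by rewrite !mulmxBr !mulmxA GX; mxring.
have all (x : nat) : (exists Y, evalmx P x%:R = evalmx P 0 *m Y) /\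
    (exists Y, evalmx P x.+1%:R = evalmx P 0 *m Y).
  elim: x => [|x [[Y PY] [Y' PY']]].
    split; first by exists 1%:M; rewrite mulmx1.
    eexists; apply: (rec 0 1%:M 0); first by rewrite mulmx1.
    by rewrite scale0r mulmx0.
  split; first by exists Y'.
  eexists; apply: (rec _ Y' (x.+1%:R *: Y) PY').
  by rewrite -natr1 addrK PY scalemxAr.
rewrite -row_free_unit -kermx_eq0; set K := kermx _.
have KP : CM K *m P = 0.
  apply: evalmx_nat_inj => x; have [[Y PY] _] := all x.
  rewrite evalmxM evalmxC PY mulmxA mulmx_ker mul0mx.
  by apply/matrixP => i j; rewrite !mxE horner0.
have [_] := leadCM K P1; rewrite KP mulmx1 => <-.
by apply/eqP/matrixP => i j; rewrite !mxE /= coef0.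
Qed.

Variables (a nu : C) (U V J Z : 'M[C]_N) (lam : nat).
Hypotheses (UV : U *m V = 1%:M) (J_U : J *m U = U *m J + U - 1%:M).
Hypothesis Z_unit : forall n : nat, Z + n%:R *: 1%:M \in unitmx.

Definition theta_shift : 'M[C]_N := a *: (U - 1%:M) + (nu + lam%:R) *: 1%:M - J.

(** For p0 = P_n(0) and p1 = P_n(1) the two equations are the eigenvalue
    equations of the operators D and Delta S at 0. As Z + n is invertible, the
    second one determines p1, which is then eliminated from the first one. *)
Lemma GammaD_theta n (p0 p1 Phi0 : 'M[C]_N) :
  Phi0 *m U ^+ lam = (a / 2) *: (U ^+ lam.+1 *m Z) ->
  p1 *m (a *: U) - p0 *m (J + lam%:R *: V) = GammaD a U V J lam n *m p0 ->
  (p0 - p1) *m Phi0 = GammaDS a nu U V J lam n *m p0 ->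
  GammaD a U V J lam n *m p0 =
  p0 *m (U ^+ lam *m (theta Z theta_shift n - Gamma_shift a nu lam n *: 1%:M)
    *m invmx (U ^+ lam)).
Proof.
rewrite /GammaDS => PhiE.
move: (GammaD _ _ _ _ _ _) => Gm eq1 eq2; set c := Gamma_shift _ _ _ _ in eq2 *.
have Su := powU_unit UV lam.
pose q0 := p0 *m U ^+ lam; pose q1 := a *: (p1 *m U ^+ lam.+1).
have E1 : Gm *m q0 = q1 - q0 *m (J + lam%:R *: 1%:M).
  rewrite /q0 mulmxA -eq1 mulmxBl -scalemxAr -scalemxAl -(mulmxA p1) -expmxS
    -/q1.
  congr (_ - _); rewrite -!mulmxA; congr (_ *m _).
  by rewrite mulmxDl (J_powU UV J_U) -scalemxAl (V_powU UV) !mxnorm; mxring.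
have E2 : q0 *m (a *: U) *m Z - q1 *m Z =
    n%:R *: (q1 - q0 *m (J + lam%:R *: 1%:M) + c *: q0).
  rewrite -E1; have := congr1 (fun M => 2 *: (M *m U ^+ lam)) eq2.
  rewrite -!scalemxAl -mulmxA PhiE (mulmxDl Gm) (mulmxDl (Gm *m p0)).
  rewrite -(mulmxA Gm) -/q0 -!scalemxAl mul1mx -/q0.
  rewrite scalerA mulrCA mulfV ?pnatr_eq0 // mulr1 => <-.
  rewrite /q1 /q0 mulmxBl -!scalemxAr -!scalemxAl -!mulmxA
    (mulmxA (U ^+ lam) U) -expmxSr.
  mxfield.
suff E : Gm *m q0 = q0 *m (theta Z theta_shift n - c *: 1%:M).
  by rewrite !mulmxA -/q0 -E /q0 -!mulmxA mulmxV // mulmx1.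
apply/eqP; rewrite -subr_eq0; apply/eqP.
apply: (unitmx_rcancel (Z_unit n)); rewrite mul0mx mulmxBl mulmxBr E1.
(* Clear the denominator Z + n of theta, then use E2 for the term q1 Z. *)
rewrite [(q0 *m theta _ _ _ - _) *m _]mulmxBl /theta mulmxA.
rewrite (mulmxKV (Z_unit n)).
rewrite -[RHS](subrr (n%:R *: (q1 - q0 *m (J + lam%:R *: 1%:M) + c *: q0))).
rewrite -{2}E2.
rewrite /theta_shift /c /Gamma_shift /q1 -!scalemxAr !mxnorm.
mxring.
Qed.
End ValuesAtZero.

(** * Commutation relations of the Charlier matrices *)

Section Family.
Variables (C : numClosedFieldType) (N : nat) (a : C) (mu : 'I_N -> C).
Hypothesis a_gt0 : 0 < a.
Hypothesis mu_gt0 : forall k, 0 < mu k.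
Hypothesis mu_rel : forall i j : 'I_N, i = j.+1 :> nat ->
  (mu i / mu j) ^+ 2 = (N - j.+1)%:R / a.

Let A := muA mu.
Let U := 1%:M + A.
Let J := Jmx C N.
Let As := A^t*.
Let B := J *m As.

Lemma a_neq0 : a != 0. Proof. by rewrite gt_eqF. Qed.
Lemma a_real : a^* = a. Proof. by apply/CrealP/gtr0_real. Qed.

Lemma muAadjE : As = A^T.
Proof.
apply/matrixP => i j; rewrite !mxE; case: ifP => _; last exact: rmorph0.
by apply/CrealP; rewrite ger0_real // divr_ge0 ?ltW.
Qed.

Lemma U_unit : U \in unitmx.
Proof.
rewrite unitmxE det_trig ?unitfE.
  apply/prodf_neq0 => i _; rewrite !mxE eqxx ltn_eqF // addr0; exact: oner_neq0.
apply/is_trig_mxP => i j ij; rewrite !mxE.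
by rewrite -val_eqE /= (ltn_eqF ij) ltn_eqF ?addr0 // ltnW.
Qed.

Lemma J_A : J *m A = A *m J + A.
Proof.
rewrite /J /Jmx mul_diag_mx mul_mx_diag; apply/matrixP => i j; rewrite !mxE.
by case: eqP => [->|_]; rewrite ?mulr0 ?mul0r ?addr0 // -natr1; ring.
Qed.

Lemma J_U : J *m U = U *m J + U - 1%:M.
Proof. by rewrite /U mulmxDr mulmxDl mulmx1 mul1mx J_A; mxring. Qed.

Lemma AsA_diag : As *m A = a^-1 *: diag_mx (\row_(k < N) (N - k.+1)%:R).
Proof.
rewrite muAadjE; apply/matrixP => i j; rewrite !mxE.
have [iN|iN] := ltnP i.+1 N; last first.
  rewrite big1 => [|k _]; last first.
    by rewrite !mxE ltn_eqF ?mul0r // (leq_trans (ltn_ord k)).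
  by move: iN; rewrite -subn_eq0 => /eqP->; rewrite mul0rn mulr0.
rewrite (bigD1 (Ordinal iN)) //= big1 => [|k ki]; last first.
  rewrite !mxE; case: eqP => [kE|_]; last by rewrite mul0r.
  by move: ki; rewrite -val_eqE /= kE eqxx.
rewrite !mxE /= eqxx eqSS addr0 -val_eqE /=.
have [/val_inj<-|ij] := eqVneq (i : nat) j; last by rewrite mulr0n !mulr0.
by rewrite -expr2 mu_rel // mulr1n mulrC.
Qed.

Lemma AAs_diag :
  A *m As =
  a^-1 *: diag_mx (\row_(k < N) (if k == 0 :> nat then 0 else (N - k)%:R)).
Proof.
rewrite muAadjE; apply/matrixP => i j; rewrite !mxE.
case: i => [[|i] iN]; rewrite /= ?mulr0.
  by rewrite mul0rn mulr0 big1 // => k _; rewrite !mxE /= mul0r.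
pose k := Ordinal (ltnW iN).
rewrite (bigD1 k) //= big1 => [|l lk]; last first.
  by move: lk; rewrite -val_eqE !mxE /= eqSS [i == l]eq_sym => /negPf->;
    rewrite mul0r.
rewrite !mxE /= eqxx -val_eqE /= addr0 [j == i.+1 :> nat]eq_sym.
have [ij|ij] := eqVneq i.+1 (j : nat); last by rewrite mulr0n !mulr0.
rewrite (_ : j = Ordinal iN); last exact: val_inj.
by rewrite -expr2 mu_rel // mulr1n mulrC.
Qed.

(** The triple A, J A^*, J spans sl2 up to scaling and translation. Only here do
    the precise ratios of the mu_j matter. *)
Lemma B_A : B *m A = A *m B + a^-1 *: (N.+1%:R *: 1%:M - 2 *: J).
Proof.
have AJ : A *m J = J *m A - A by rewrite J_A; mxring.
rewrite /B mulmxA AJ mulmxBl -!mulmxA AsA_diag AAs_diag /J /Jmx.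
rewrite !scalemx_mulr !mulmx_diag; apply/matrixP => i j; rewrite !mxE.
have a0 := a_neq0.
have [_|_] := eqVneq i j; last by rewrite !mulr0n; field.
rewrite !mulr1n.
case: i => [[|i] iN] /=.
  rewrite natrB // -natr1; field; exact: a0.
rewrite !natrB // ?(ltnW iN) // -!natr1; field; exact: a0.
Qed.

Lemma B_U : B *m U = U *m B + a^-1 *: (N.+1%:R *: 1%:M - 2 *: J).
Proof. by rewrite /U mulmxDr mulmxDl mulmx1 mul1mx B_A; mxring. Qed.

Variable lam : nat.
Let T := Tmx N a lam.

(** With 1-based indices, k delta_(k+1) = (lam + k) delta_k. *)
Lemma J_As_T : J *m As *m T = (J + lam%:R *: 1%:M) *m T *m As.
Proof.
rewrite mulmxDl mulmxDl -scalemxAl mul1mx -scalemxAl.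
rewrite muAadjE /J /Jmx /T /Tmx mul_mx_diag.
rewrite -[_ *m diag_mx _ *m _]mulmxA !mul_diag_mx.
apply/matrixP => i j; rewrite !mxE; case: eqP => [->|_]; last first.
  by rewrite !mulr0 mul0r addr0.
rewrite /delta addnS !factS !natrM -!natr1 natrD.
have k0 : i%:R + 1 != 0 :> C by rewrite natr1 pnatr_eq0.
have f0 : (i`!)%:R != 0 :> C by rewrite pnatr_eq0 -lt0n fact_gt0.
set h := (a / 2) ^+ lam; field.
by rewrite f0 k0 gt_eqF.
Qed.

Lemma J_T : J *m T = T *m J.
Proof.
rewrite /J /T /Jmx /Tmx !mulmx_diag; congr diag_mx.
by apply/rowP => i; rewrite !mxE mulrC.
Qed.

Lemma diag_adj (d : 'rV[C]_N) : (forall i, d 0 i \is Num.real) ->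
  (diag_mx d)^t* = diag_mx d.
Proof.
move=> dR; rewrite tr_diag_mx map_diag_mx; congr diag_mx.
by apply/rowP => i; rewrite mxE; apply/CrealP.
Qed.

Lemma J_adj : J^t* = J.
Proof. by apply: diag_adj => i; rewrite mxE realn. Qed.

Lemma delta_gt0 k : 0 < delta a lam k.
Proof.
by rewrite divr_gt0 ?mulr_gt0 ?exprn_gt0 ?divr_gt0 ?ltr0n ?fact_gt0.
Qed.

Lemma T_adj : T^t* = T.
Proof. by apply: diag_adj => i; rewrite mxE gtr0_real // delta_gt0. Qed.

Lemma JAsAT_adj : (J *m As *m A *m T)^t* = J *m As *m A *m T.
Proof.
rewrite -(mulmxA J) AsA_diag /J /T /Jmx /Tmx -[a^-1 *: diag_mx _]linearZ /=.
rewrite !mulmx_diag; apply: diag_adj => i; rewrite !mxE.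
rewrite ger0_real // mulr_ge0 //; last exact: ltW (delta_gt0 _).
by rewrite !mulr_ge0 ?ler0n ?invr_ge0 ?ltW.
Qed.
End Family.

(** * The three Charlier operators *)

Section Charlier.
Variables (C : numClosedFieldType) (N : nat) (a : C) (mu : 'I_N -> C).
Hypothesis a_gt0 : 0 < a.
Hypothesis mu_gt0 : forall k, 0 < mu k.
Hypothesis mu_rel : forall i j : 'I_N, i = j.+1 :> nat ->
  (mu i / mu j) ^+ 2 = (N - j.+1)%:R / a.
Hypothesis cvg1 : cvgn (series (charlier_term a 1)).
Variables (lam : nat) (P : nat -> 'M[{poly C}]_N).
Hypothesis P_orth : monic_orthogonal (Wcharlier a mu lam) P.

Local Notation CM M := (map_mx (@polyC C) M).
Local Notation A := (muA mu).
Local Notation U := (1%:M + muA mu).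
Local Notation Us := ((1%:M + muA mu)^t*).
Local Notation V := (invmx (1%:M + muA mu)).
Local Notation J := (Jmx C N).
Local Notation T := (Tmx N a lam).
Local Notation nu := (N.+1%:R : C).
Local Notation Up := (fun l : nat => unipow (muA mu) ('X + (l%:R)%:P)).
Local Notation Phi := (PhiS a mu).
Local Notation W := (Wpol T lam Up).

Let a0 : a != 0 := a_neq0 a_gt0.
Let ar : a^* = a := a_real a_gt0.
Let UV : U *m V = 1%:M := mulmxV (U_unit mu).
Let JU : J *m U = U *m J + U - 1%:M := J_U mu.

Lemma Us_sub1 : Us - 1%:M = A^t*.
Proof. by rewrite adjD adj1 addrC addKr. Qed.

Lemma JUs_U : J *m Us *m U =
  U *m (J *m Us) + (U - 1%:M) + a^-1 *: (nu *: 1%:M - 2 *: J).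
Proof.
have E : J *m Us = J + J *m A^t* by rewrite -Us_sub1 mulmxBr mulmx1; mxring.
rewrite E (mulmxDl J) (mulmxDr U) JU (B_U a_gt0 mu_gt0 mu_rel); mxring.
Qed.

Lemma J_Us_T : J *m Us *m T = J *m T + (J + lam%:R *: 1%:M) *m T *m (Us - 1%:M).
Proof.
rewrite Us_sub1 -(J_As_T a mu_gt0) -Us_sub1 mulmxBr mulmx1 mulmxBl; mxring.
Qed.

Lemma JAsAT_herm : (J *m (Us - 1%:M) *m (U - 1%:M) *m T)^t* =
  J *m (Us - 1%:M) *m (U - 1%:M) *m T.
Proof.
rewrite Us_sub1 (_ : U - 1%:M = A) ?(JAsAT_adj a_gt0 mu_gt0 mu_rel) //.
by rewrite addrC addKr.
Qed.

Lemma Up_nat l x : evalmx (Up l) x%:R = U ^+ (x + l).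
Proof. by apply: evalmx_unipow_nat (muA_nilp mu) _; rewrite !hornerE natrD. Qed.

Lemma Phi_nat l x : evalmx (Phi l) x%:R *m U ^+ (x + l) =
  (a / 2) *: (U ^+ (x + l).+1 *m (J *m Us + l%:R *: 1%:M)).
Proof.
rewrite PhiS_nat -scalemxAl mulmxKV ?(powU_unit UV) // addn1 adjD adj1.
by [].
Qed.

Lemma PhiPsiE l : PhiPsiS mu l = 'X *: Gpol V J l.
Proof.
apply: evalmx_nat_inj => x; rewrite PhiPsiS_nat evalmxZ hornerX.
apply: (unitmx_rcancel (powU_unit UV (x + l))).
rewrite -!scalemxAl mulmxKV ?(powU_unit UV) // (Gpol_nat UV JU) scalerA.
by [].
Qed.

(** The matrix is upper triangular with positive diagonal entries. *)
Lemma JUs_unit (c : nat) : J *m Us + c%:R *: 1%:M \in unitmx.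
Proof.
rewrite -unitmx_tr unitmxE det_trig ?unitfE.
  apply/prodf_neq0 => i _.
  rewrite mxE /Jmx mul_diag_mx adjD adj1 (muAadjE mu_gt0) !mxE eqxx.
  by rewrite ltn_eqF // addr0 !mulr1 -natrD pnatr_eq0.
apply/is_trig_mxP => i j ij.
rewrite mxE /Jmx mul_diag_mx adjD adj1 (muAadjE mu_gt0) !mxE.
by rewrite -val_eqE /= gtn_eqF // (ltn_eqF (ltnW _)) // !addr0 !mulr0 addr0.
Qed.

Lemma Phi_unit l x : evalmx (Phi l) x%:R \in unitmx.
Proof.
have : evalmx (Phi l) x%:R *m U ^+ (x + l) \in unitmx.
  rewrite Phi_nat unitmxZ ?unitfE ?mulf_neq0 ?invr_eq0 ?pnatr_eq0 //.
  by rewrite unitmx_mul (powU_unit UV) JUs_unit.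
by rewrite unitmx_mul => /andP[].
Qed.

Lemma Wcharlier_nat x : Wcharlier a mu lam x =
  (a ^+ x / (x`!)%:R) *: evalmx W x%:R.
Proof.
by rewrite (Wpol_nat _ _ Up_nat) adjX adjD adj1.
Qed.

Lemma inner_charlier (Q R : 'M[{poly C}]_N) G :
  inner_is (Wcharlier a mu lam) Q R G ->
  forall i j, charlier_sum a ((Q *m W *m pstar R) i j) = G i j.
Proof.
move=> QR i j; apply/charlier_sumP => //.
rewrite (_ : charlier_term a _ = fun x : nat => (evalmx Q x%:R *m
  Wcharlier a mu lam x *m (evalmx R x%:R)^t*) i j); first exact: QR.
apply/funext => x; rewrite /charlier_term Wcharlier_nat -scalemxAr -scalemxAl
  -evalmx_pstar ?realn //.
by rewrite -!evalmxM [RHS]mxE [X in _ = _ * X]mxE.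
Qed.

(** The i-th diagonal entry of Q(x) W(x) Q(x)^* is the sum of the squared moduli
    of the entries in the i-th row of Q(x) U^(x + lam), with weights
    delta_k > 0. *)
Lemma charlier_pairing_def (L : {scalar {poly C}}) :
  (forall p, L p = charlier_sum a p) ->
  forall Q : 'M[{poly C}]_N, pairing L W Q Q = 0 -> Q = 0.
Proof.
move=> LE Q Q0; apply: evalmx_nat_inj => x.
rewrite [RHS](_ : _ = 0); last by apply/matrixP => i j; rewrite !mxE horner0.
have val (y : nat) i : ((Q *m W *m pstar Q) i i).[y%:R] =
    \sum_(k < N) delta a lam k * `|(evalmx Q y%:R *m U ^+ (y + lam)) i k| ^+ 2.
  have -> : ((Q *m W *m pstar Q) i i).[y%:R] =
    evalmx (Q *m W *m pstar Q) y%:R i i.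
    by rewrite [RHS]mxE.
  rewrite !(evalmxM (Q *m W)) (evalmxM Q) (Wpol_nat _ _ Up_nat) evalmx_pstar
    ?realn //.
  rewrite !mulmxA -[_ *m _^t* *m _]mulmxA -adjM; set Y := _ *m U ^+ _.
  rewrite /Tmx mul_mx_diag mxE; apply: eq_bigr => k _.
  by rewrite !mxE normCK; ring.
apply: (unitmx_rcancel (powU_unit UV (x + lam))); rewrite mul0mx.
apply/matrixP => i k; rewrite [RHS]mxE.
have := charlier_sum_eq0 cvg1 a_gt0 _ _.
move=> /(_ ((Q *m W *m pstar Q) i i)).
have pos y : 0 <= ((Q *m W *m pstar Q) i i).[y%:R].
  rewrite val sumr_ge0 // => l _.
  by rewrite mulr_ge0 ?exprn_ge0 // ltW ?delta_gt0.
have : pairing L W Q Q i i = 0 by rewrite Q0 mxE.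
rewrite mxE LE => s0 /(_ pos s0 x)/eqP; rewrite val psumr_eq0 => [|l _];
  last first.
  by rewrite mulr_ge0 ?exprn_ge0 // ltW ?delta_gt0.
move=> /allP/(_ k (mem_index_enum _)).
by rewrite /= mulf_eq0 (gt_eqF (delta_gt0 a_gt0 _ _)) expf_eq0 normr_eq0 =>
  /eqP.
Qed.

Lemma polyopB F1 F0 G (Q R : 'M[{poly C}]_N) :
  polyop F1 F0 G (Q - R) = polyop F1 F0 G Q - polyop F1 F0 G R.
Proof. by rewrite /polyop !(pshiftD, pshiftN) !(mulmxDl, mulNmx); mxring. Qed.

(** For an operator whose last coefficient is divisible by x, symmetry and
    degree preservation are all that the eigenvalue equation requires. *)
Lemma charlier_eigen F1 F0 G (Gamma : nat -> 'M[C]_N) :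
  F0 *m W = W *m pstar F0 ->
  F1 *m W = a%:P *: pshift 1 (W *m pstar G) ->
  (forall n Q M, lead n Q M -> lead n (polyop F1 F0 ('X *: G) Q)
    (M *m Gamma n)) ->
  forall n, polyop F1 F0 ('X *: G) (P n) = CM (Gamma n) *m P n.
Proof.
move=> F0W F1W Dlead; have [L LE] := charlier_functional cvg1.
have [Pm Po] := P_orth.
have Ws : pstar W = W by apply: Wpol_star; apply: T_adj.
apply: (symmetric_eigen (L := L) (W := W)) => //.
- by move=> n; exact: monic_deg_lead.
- move=> m n mn; apply/matrixP => i j; rewrite [LHS]mxE LE.
  by rewrite (inner_charlier (Po m n mn)).
- exact: charlier_pairing_def LE.
- move=> Q R; apply: (polyop_adjoint ar _ Ws) => // p.
  by rewrite !LE charlier_sum_shift.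
- exact: polyopB.
Qed.

Local Notation G1 n := (GammaD a U V J lam n).
Local Notation G2 n := (GammaDS a nu U V J lam n).
Local Notation G3 n := (GammaSD a nu U V J lam n).
Local Notation F10 := (- CM J - ('X + lam%:R%:P) *: CM V).

Lemma Dop_eigen n :
  polyop (CM (a *: U)) F10 ('X *: CM V) (P n) = CM (G1 n) *m P n.
Proof.
apply: charlier_eigen.
- exact: (Dop_coef0_symmetric UV JU _ (J_T _ _ _) (J_adj _ _)
    (T_adj _ a_gt0 _) Up_nat).
- exact: (Dop_coef1_adjoint _ UV _ (T_adj _ a_gt0 _) Up_nat).
- by move=> k Q M; exact: Dop_lead.
Qed.

Lemma DeltaS_eigen n :
  polyop (- Phi lam) (Phi lam + 'X *: Gpol V J lam) ('X *: - Gpol V J lam) (P n)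
  = CM (G2 n) *m P n.
Proof.
apply: charlier_eigen.
- exact: (DeltaS_coef0_symmetric ar UV JU (J_T _ _ _) (J_adj _ _)
    (T_adj _ a_gt0 _) J_Us_T Up_nat Phi_nat).
- exact: (DeltaS_coef1_adjoint UV JU (J_T _ _ _) (J_adj _ _)
    (T_adj _ a_gt0 _) J_Us_T Up_nat Phi_nat).
- move=> k Q M; apply: DeltaS_lead; apply: (Phi_decomp a0 UV JU JUs_U) => x.
  exact: Phi_nat.
Qed.

Lemma SDelta_eigen l n : lam = l.+1 ->
  polyop (- pshift 1 (Phi l)) (Phi l + pshift 1 ('X *: Gpol V J l))
    ('X *: - Gpol V J l) (P n) = CM (G3 n) *m P n.
Proof.
move=> lamE; apply: charlier_eigen.
- exact: (SDelta_coef0_symmetric ar UV JU (J_T _ _ _) (J_adj _ _)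
    (T_adj _ a_gt0 _) J_Us_T JAsAT_herm Up_nat Phi_nat lamE).
- exact: (SDelta_coef1_adjoint UV JU (J_T _ _ _) (J_adj _ _)
    (T_adj _ a_gt0 _) J_Us_T Up_nat Phi_nat lamE).
- move=> k Q M; apply: (SDelta_lead lamE).
  by apply: (Phi_decomp a0 UV JU JUs_U) => x; exact: Phi_nat.
Qed.

Local Notation Z := (J *m Us + lam%:R *: 1%:M).
Local Notation L := (theta_shift a nu U J lam).
Local Notation S := (U ^+ lam).

Lemma Z_unit n : Z + n%:R *: 1%:M \in unitmx.
Proof. by rewrite -addrA -scalerDl -natrD JUs_unit. Qed.

Lemma GammaD_eval0 n : G1 n *m evalmx (P n) 0 = evalmx (P n) 0 *m
  (S *m (theta Z L n - Gamma_shift a nu lam n *: 1%:M) *m invmx S).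
Proof.
have Phi0 : evalmx (Phi lam) 0 *m S = (a / 2) *: (U ^+ lam.+1 *m Z).
  exact: (Phi_nat lam 0).
have eq1 := congr1 (fun M => evalmx M 0) (Dop_eigen n).
have eq2 := congr1 (fun M => evalmx M 0) (DeltaS_eigen n).
rewrite !evalmx_polyop !(evalmxM (CM _)) !evalmxC !evalmx0X mulmx0 addr0
  add0r in eq1.
rewrite !evalmx_polyop !(evalmxM (CM _)) !evalmxC !evalmx0X mulmx0 addr0
  add0r in eq2.
apply: (GammaD_theta UV JU Z_unit Phi0 (p1 := evalmx (P n) 1)).
  rewrite -eq1 evalmxD !evalmxN evalmxZ !evalmxC !hornerE -opprD mulmxN.
  by [].
rewrite -eq2 evalmxD evalmxN evalmx0X addr0 mulmxN mulmxBl; mxring.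
Qed.

Lemma charlier_eval0_unit n : evalmx (P n) 0 \in unitmx.
Proof.
have [Pm _] := P_orth.
apply: eval0_unit (monic_deg_lead (Pm n)) (Dop_eigen n) _ (GammaD_eval0 n) => x.
by rewrite evalmxC unitmxZ ?unitfE ?a0 // U_unit.
Qed.

(** The matrices rho(n) are found without knowing P_n(0), from how the
    eigenvalue matrix commutes past it. *)
Lemma rho_of_intertwining (f g : C) n (Gam : 'M[C]_N) :
  Gam *m evalmx (P n) 0 = evalmx (P n) 0 *m
    (S *m (f *: theta Z L n + g *: 1%:M) *m invmx S) ->
  invmx (evalmx (P n) 0) *m Gam *m evalmx (P n) 0 =
    S *m (f *: theta Z L n + g *: 1%:M) *m invmx S.
Proof. by move=> E; rewrite -mulmxA E mulKmx // charlier_eval0_unit. Qed.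

Lemma conj_scalar g : S *m (g *: 1%:M) *m invmx S = g *: 1%:M.
Proof. by rewrite -scalemxAr mulmx1 -scalemxAl mulmxV // (powU_unit UV). Qed.

Lemma GammaD_shift_eval0 n g : (G1 n + g *: 1%:M) *m evalmx (P n) 0 =
  evalmx (P n) 0 *m
  (S *m (theta Z L n + (g - Gamma_shift a nu lam n) *: 1%:M) *m invmx S).
Proof.
have -> : theta Z L n + (g - Gamma_shift a nu lam n) *: 1%:M =
    (theta Z L n - Gamma_shift a nu lam n *: 1%:M) + g *: 1%:M by mxring.
rewrite (mulmxDl _ (g *: 1%:M)) GammaD_eval0; move: (theta Z L n - _) => X.
rewrite (mulmxDr S) (mulmxDl (S *m X)) conj_scalar mulmxDr.
by rewrite -scalemxAl mul1mx -scalemxAr mulmx1.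
Qed.

Lemma Dop_BR2 : BR2 P (Dop a mu lam).
Proof.
apply: (BR2_polyop _ Dop_eigen charlier_eval0_unit).
- move=> Q; rewrite /Dop /difop_of /eta /constmx /=.
  by rewrite polymxD !polymxN mulmxDr !mulmxN addrA.
- by move=> x; rewrite evalmxC unitmxZ ?unitfE ?a0 // U_unit.
(* rho(n) / n tends to -1. *)
rewrite (_ : (fun n => _) = affine_rho S Z L 0 1 (-1) (a - nu - 2 * lam%:R)).
  apply: affine_rho_condV; [exact: (powU_unit UV)|exact: Z_unit|].
  by rewrite scale0r add0r unitmxZ ?unitmx1 // unitfE oppr_eq0 oner_neq0.
apply/funext => n; apply: rho_of_intertwining; rewrite GammaD_eval0;
  congr (_ *m (_ *m _ *m _)).
by rewrite /Gamma_shift; mxring.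
Qed.

Lemma DeltaS_BR2 : BR2 P (@Delta C N \; Sop a mu lam).
Proof.
apply: (BR2_polyop _ DeltaS_eigen charlier_eval0_unit).
- by move=> Q; rewrite /Sop Delta_comp_difop PhiPsiE scalerN.
- by move=> x; rewrite evalmxN -scaleN1r unitmxZ ?unitfE ?oppr_eq0 ?oner_neq0
  // Phi_unit.
(* rho(n) / n tends to a conjugate of Z / 2. *)
rewrite (_ : (fun n => _) = affine_rho S Z L (2^-1) 0 0 0).
  apply: affine_rho_condV; [exact: (powU_unit UV)|exact: Z_unit|].
  by rewrite scale0r addr0 unitmxZ ?JUs_unit // unitfE invr_eq0 pnatr_eq0.
apply/funext => n; apply: rho_of_intertwining.
rewrite /GammaDS -scalemxAl GammaD_shift_eval0 scalemxAr scalemxAl scalemxAr.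
by congr (_ *m (_ *m _ *m _)); mxring.
Qed.

Lemma SDelta_BR2 : (1 <= lam)%N -> BR2 P (Sop a mu lam.-1 \; @Delta C N).
Proof.
move=> lam1; have lamE : lam = lam.-1.+1 by rewrite prednK.
apply: (BR2_polyop _ (fun n => SDelta_eigen n lamE) charlier_eval0_unit).
- by move=> Q; rewrite /Sop difop_comp_Delta PhiPsiE scalerN.
- move=> x; rewrite evalmxN evalmx_shift natr1 -scaleN1r.
  by rewrite unitmxZ ?unitfE ?oppr_eq0 ?oner_neq0 // Phi_unit.
(* rho(n) / n tends to a conjugate of (Z - 1) / 2, invertible as lam > 0. *)
rewrite (_ : (fun n => _) = affine_rho S Z L (2^-1) (2^-1) (- 2^-1) (- 2^-1)).
  apply: affine_rho_condV; [exact: (powU_unit UV)|exact: Z_unit|].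
  rewrite scaleNr -scalerBr unitmxZ ?unitfE ?invr_eq0 ?pnatr_eq0 //.
  have lamR : lam%:R = lam.-1%:R + 1 :> C by rewrite natr1 -lamE.
  rewrite (_ : _ - _ = J *m Us + lam.-1%:R *: 1%:M) ?JUs_unit //.
  by rewrite lamR; mxring.
apply/funext => n; apply: rho_of_intertwining.
rewrite /GammaSD -scalemxAl GammaD_shift_eval0 scalemxAr scalemxAl scalemxAr
  -[n.+1%:R]natr1.
by congr (_ *m (_ *m _ *m _)); mxring.
Qed.
End Charlier.

(** * Specialization to the complex numbers *)

Local Open Scope complex_scope.

Lemma cvg_real_complex (R : realType) (u : nat -> R) (l : R) :
  let C : numClosedFieldType := R[i] in
  u @ \oo --> l -> (fun n => (u n)%:C : C) @ \oo --> (l%:C : C).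
Proof.
move=> C /cvgrPdist_lt ul; apply/cvgrPdist_lt => e e0.
have [eR eE] : exists r : R, e = r%:C.
  by exists (complex.Re e); rewrite RRe_real // gtr0_real.
rewrite eE ltcR in e0; have := ul _ e0; apply: filterS => n.
by rewrite -rmorphB normc_def /= expr0n /= addr0 sqrtr_sqr eE ltcR.
Qed.

Lemma cvg_charlier1 (R : realType) (a : R) :
  let C : numClosedFieldType := R[i] in
  cvgn (series (charlier_term (a%:C : C) 1)).
Proof.
move=> C; have /cvg_ex[l lE] := is_cvg_series_exp_coeff a.
apply/cvg_ex; exists l%:C; apply: cvg_trans (cvg_real_complex lE).
rewrite (_ : series (charlier_term _ 1) =
  (fun n => (series (exp_coeff a) n)%:C)) //.
apply/funext => m; rewrite /series /= rmorph_sum /=; apply: eq_bigr => i _.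
by rewrite /charlier_term hornerE mulr1 /exp_coeff fmorph_div rmorphXn
  rmorph_nat.
Qed.

Theorem lemma8p5 (R : realType) (N : nat) (a : R) (mu : 'I_N -> R)
  (N_ge1 : (1 <= N)%N) (a_gt0 : 0 < a)
  (mu_gt0 : forall k, 0 < mu k)
  (mu_rel : forall j k : 'I_N,
     (mu j / mu k) ^+ 2 =
     a ^ (k%:Z - j%:Z) * ((N - k.+1)`!)%:R / ((N - j.+1)`!)%:R)
  (lam : nat) (P : nat -> 'M[{poly R[i]}]_N) :
  let aC := a%:C in
  let muC := fun k => (mu k)%:C in
  monic_orthogonal (Wcharlier aC muC lam) P ->
  [/\ BR2 P (Dop aC muC lam),
      BR2 P (@Delta R[i] N \; Sop aC muC lam)
    & (1 <= lam)%N -> BR2 P (Sop aC muC lam.-1 \; @Delta R[i] N)].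
Proof.
move=> aC muC Port.
have aC0 : 0 < aC by rewrite /aC ltcR.
have muC0 k : 0 < muC k by rewrite /muC ltcR.
have muCr (i j : 'I_N) : i = j.+1 :> nat ->
    (muC i / muC j) ^+ 2 = (N - j.+1)%:R / aC.
  move=> ij; rewrite /muC /aC -fmorph_div -rmorphXn mu_rel ij.
  rewrite -[in RHS](rmorph_nat (real_complex R)) -fmorph_div; congr (_%:C).
  have jN : (j.+1 < N)%N by rewrite -ij.
  have -> : (j%:Z - j.+1%:Z)%R = (- 1)%R :> int.
    by rewrite -addn1 PoszD opprD addrA subrr.
  have -> : (N - j.+1 = (N - j.+2).+1)%N by rewrite -subSn.
  rewrite factS natrM -exprnN expr1.
  have f0 : ((N - j.+2)`!)%:R != 0 :> R by rewrite pnatr_eq0 -lt0n fact_gt0.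
  by field; rewrite f0 gt_eqF.
have c1 := @cvg_charlier1 R a.
split.
- exact: (Dop_BR2 aC0 muC0 muCr c1 Port).
- exact: (DeltaS_BR2 aC0 muC0 muCr c1 Port).
- exact: (SDelta_BR2 aC0 muC0 muCr c1 Port).
Qed.
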